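(* Let $\mathfrak{X}$ be an abstract state space, $(\mathcal{U}(t))_{t\ge0}$ a substochastic $C_0$-semigroup on $\mathfrak{X}$ with generator $\mathcal{A}$, $\mathcal{B}:\mathscr{D}(\mathcal{A})\to\mathfrak{X}$ a positive linear operator with $\langle\mathbf{\Psi},(\mathcal{A}+\mathcal{B})u\rangle\le0$ for all $u\in\mathscr{D}(\mathcal{A})\cap\mathfrak{X}_+$, let $\mathcal{G}$ be the generator of the associated minimal semigroup $(\mathcal{V}(t))_{t\ge0}$ and $(\mathcal{V}_n(t))_{t\ge0}$, $n\ge0$, the Dyson–Phillips iterates. Then for any $v\in\mathscr{D}(\mathcal{G})$ the limit $$\widehat{\mathfrak{a}}(v):=\lim_{t\to0^+}\frac1t\sum_{n=0}^\infty\mathfrak{a}\left(\int_0^t\mathcal{V}_n(s)v\,\mathrm{d}s\right)$$ exists, with $|\widehat{\mathfrak{a}}(v)|\le4M(\|v\|+\|\mathcal{G}v\|)$. Furthermore, for $v\in\mathscr{D}(\mathcal{G})_+=\mathscr{D}(\mathcal{G})\cap\mathfrak{X}_+$, $\widehat{\mathfrak{a}}(v)\le\mathfrak{a}_0(v)\le\|\mathcal{G}v\|$.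
   Context: An abstract state space is a real ordered Banach space $\mathfrak{X}$ whose positive cone $\mathfrak{X}_+$ is closed, generating ($\mathfrak{X}=\mathfrak{X}_+-\mathfrak{X}_+$), and on which the norm is additive: $\|u+v\|=\|u\|+\|v\|$ for $u,v\in\mathfrak{X}_+$. $\mathbf{\Psi}\in\mathfrak{X}^\star_+$ is the positive functional with $\langle\mathbf{\Psi},u\rangle=\|u\|$ for $u\in\mathfrak{X}_+$. $M>0$ is a fixed constant such that every $u\in\mathfrak{X}$ can be written $u=u_1-u_2$ with $u_i\in\mathfrak{X}_+$ and $\|u_i\|\le M\|u\|$, $i=1,2$ (such a constant always exists). A linear operator is positive if it maps positive elements of its domain into $\mathfrak{X}_+$. A $C_0$-semigroup $(T(t))_{t\ge0}$ is substochastic if each $T(t)$ is positive and $\|T(t)u\|\le\|u\|$ for $u\in\mathfrak{X}_+$. Minimal semigroup: under the stated hypotheses there is a smallest (for the operator order, for each $t$) substochastic $C_0$-semigroup $(\mathcal{V}(t))_{t\ge0}$ whose generator $\mathcal{G}$ extends $(\mathcal{A}+\mathcal{B},\mathscr{D}(\mathcal{A}))$; it satisfies $(\lambda-\mathcal{G})^{-1}u=\lim_{n\to\infty}(\lambda-\mathcal{A})^{-1}\sum_{k=0}^n[\mathcal{B}(\lambda-\mathcal{A})^{-1}]^ku$ for all $\lambda>0$, $u\in\mathfrak{X}$, and $\mathcal{V}(t)u=\sum_{n\ge0}\mathcal{V}_n(t)u$. Dyson–Phillips iterates: $\mathcal{V}_0(t)=\mathcal{U}(t)$, and $\mathcal{V}_{n+1}(t)$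 is the unique bounded (positive) operator on $\mathfrak{X}$ with $\mathcal{V}_{n+1}(t)u=\int_0^t\mathcal{V}_n(t-s)\mathcal{B}\,\mathcal{U}(s)u\,\mathrm{d}s$ for $u\in\mathscr{D}(\mathcal{A})$, $t\ge0$, $n\ge0$; one has $\int_0^t\mathcal{V}_n(s)v\,\mathrm{d}s\in\mathscr{D}(\mathcal{A})$ for $v\in\mathfrak{X}$. Functionals: $\mathfrak{a}_0(u)=-\langle\mathbf{\Psi},\mathcal{G}u\rangle$ for $u\in\mathscr{D}(\mathcal{G})$; $\mathfrak{a}$ is its restriction to $\mathscr{D}(\mathcal{A})$, i.e. $\mathfrak{a}(u)=-\langle\mathbf{\Psi},\mathcal{A}u+\mathcal{B}u\rangle$. *)

(* Defs.v *)
(* Stdlib reals with Coquelicot: Banach spaces are [CompleteNormedModule R_AbsRing],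
   and [RInt] is the vector-valued Riemann integral. *)
From Stdlib Require Import Reals.
From Coquelicot Require Import Coquelicot.
Open Scope R_scope.

Set Implicit Arguments.
Unset Strict Implicit.

(* The order of the space is the one induced by the cone [C]:
   [u <= v] means [C (minus v u)]. *)
Record abstract_state_space (X : CompleteNormedModule R_AbsRing)
    (C : X -> Prop) : Prop := {
  cone_zero : C zero;
  cone_plus : forall u v, C u -> C v -> C (plus u v);
  cone_scal : forall (a : R) u, 0 <= a -> C u -> C (scal a u);
  cone_pointed : forall u, C u -> C (opp u) -> u = zero;
  cone_closed : closed C;
  cone_generating : forall u, exists u1 u2, C u1 /\ C u2 /\ u = minus u1 u2;
  cone_norm_additive :
    forall u v, C u -> C v -> norm (plus u v) = norm u + norm v
}.

(* [Psi] is a bounded linear functional ([is_linear] includes boundedness) that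
   is the norm on [C]. Since [C] is generating it is determined by this, and it
   is automatically positive. *)
Definition norm_functional (X : CompleteNormedModule R_AbsRing)
    (C : X -> Prop) (Psi : X -> R) : Prop :=
  is_linear Psi /\ forall u, C u -> Psi u = norm u.

Definition decomposition_constant (X : CompleteNormedModule R_AbsRing)
    (C : X -> Prop) (M : R) : Prop :=
  0 < M /\
  forall u, exists u1 u2,
    C u1 /\ C u2 /\ u = minus u1 u2 /\
    norm u1 <= M * norm u /\ norm u2 <= M * norm u.

(* An operator with a domain; the values of [op] outside [dom] carry no meaning. *)
Record operator (X : CompleteNormedModule R_AbsRing) := Operator {
  dom : X -> Prop;
  op :> X -> X
}.

Definition linear_on (X : CompleteNormedModule R_AbsRing)
    (D : X -> Prop) (T : X -> X) : Prop :=
  (forall u v, D u -> D v -> T (plus u v) = plus (T u) (T v)) /\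
  (forall (a : R) u, D u -> T (scal a u) = scal a (T u)).

Definition positive_on (X : CompleteNormedModule R_AbsRing)
    (C D : X -> Prop) (T : X -> X) : Prop :=
  forall u, D u -> C u -> C (T u).

(* Semigroups are functions on [R] of which only the values at [t >= 0] matter. *)
Record C0_semigroup (X : CompleteNormedModule R_AbsRing)
    (T : R -> X -> X) : Prop := {
  semigroup_bounded : forall t, 0 <= t -> is_linear (T t);
  semigroup_zero : forall u, T 0 u = u;
  semigroup_plus :
    forall s t u, 0 <= s -> 0 <= t -> T (s + t) u = T s (T t u);
  semigroup_cont :
    forall u, filterlim (fun t => T t u) (at_right 0) (locally u)
}.

Definition substochastic (X : CompleteNormedModule R_AbsRing)
    (C : X -> Prop) (T : R -> X -> X) : Prop :=
  C0_semigroup T /\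
  forall t u, 0 <= t -> C u -> C (T t u) /\ norm (T t u) <= norm u.

Definition is_generator (X : CompleteNormedModule R_AbsRing)
    (T : R -> X -> X) (A : operator X) : Prop :=
  forall u w,
    (dom A u /\ A u = w) <->
    filterlim (fun t => scal (/ t) (minus (T t u) u)) (at_right 0) (locally w).

Definition extends_sum (X : CompleteNormedModule R_AbsRing)
    (G A : operator X) (B : X -> X) : Prop :=
  forall u, dom A u -> dom G u /\ G u = plus (A u) (B u).

Definition minimal_semigroup (X : CompleteNormedModule R_AbsRing)
    (C : X -> Prop) (A : operator X) (B : X -> X)
    (V : R -> X -> X) (G : operator X) : Prop :=
  substochastic C V /\ is_generator V G /\ extends_sum G A B /\
  forall (W : R -> X -> X) (H : operator X),
    substochastic C W -> is_generator W H -> extends_sum H A B ->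
    forall t u, 0 <= t -> C u -> C (minus (W t u) (V t u)).

Definition dyson_phillips (X : CompleteNormedModule R_AbsRing)
    (C : X -> Prop) (U : R -> X -> X) (A : operator X) (B : X -> X)
    (Vn : nat -> R -> X -> X) : Prop :=
  (forall t u, 0 <= t -> Vn 0%nat t u = U t u) /\
  forall n t, 0 <= t ->
    is_linear (Vn (S n) t) /\
    positive_on C (fun _ => True) (Vn (S n) t) /\
    forall u, dom A u ->
      is_RInt (fun s => Vn n (t - s) (B (U s u))) 0 t (Vn (S n) t u).

Definition frak_a0 (X : CompleteNormedModule R_AbsRing)
    (Psi : X -> R) (G : operator X) (u : X) : R :=
  - Psi (G u).

(* Meaningful for [u] in [dom A] only. *)
Definition frak_a (X : CompleteNormedModule R_AbsRing)
    (Psi : X -> R) (A : operator X) (B : X -> X) (u : X) : R :=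
  - Psi (plus (A u) (B u)).

(* [l] is the limit defining the functional a-hat at [v]. As [RInt], [frak_a] and
   [Series] are total, the first two clauses say that the expression under the
   limit is meaningful: the integrals exist and lie in the domain of [A], and
   the series converges. *)
Definition is_a_hat (X : CompleteNormedModule R_AbsRing)
    (Psi : X -> R) (A : operator X) (B : X -> X)
    (Vn : nat -> R -> X -> X) (v : X) (l : R) : Prop :=
  (forall n t, 0 < t ->
     ex_RInt (fun s => Vn n s v) 0 t /\
     dom A (RInt (fun s => Vn n s v) 0 t)) /\
  (forall t, 0 < t ->
     ex_series (fun n => frak_a Psi A B (RInt (fun s => Vn n s v) 0 t))) /\
  filterlim
    (fun t => / t *
       Series (fun n => frak_a Psi A B (RInt (fun s => Vn n s v) 0 t)))
    (at_right 0) (locally l).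

(* Main.v *)
Require Import Defs.
From Stdlib Require Import Reals Lra Lia List ssreflect ClassicalEpsilon.
From Coquelicot Require Import Coquelicot.
Open Scope R_scope.

(** Write [W_n = V_0 + ... + V_n]. Since [|B w| <= - Psi (A w)] for [w >= 0] in the
    domain of [A], each [W_n] contracts the norm on the cone, so what the iterates
    [V_k], [k >= 1], carry at time [h] is at most the mass [Psi u - Psi (U h u)] that
    [U] has lost. Hence [W_n] converges to a substochastic semigroup whose generator
    extends [A + B]; it lies above [V] by minimality and below [V] by Duhamel's formula.

    Set [alpha t v = sum_n a(int_0^t V_n v)]. On the cone the terms are nonnegative and
    telescope, so that [0 <= alpha t v <= Psi v - Psi (V t v)]; moreover
    [alpha (t + s) v = alpha t v + alpha s (V t v)]. For [v] in the domain of [G] we have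
    [V t v = v + int_0^t V (G v)], so [F t = alpha t v - int_0^t alpha r (G v) dr] is
    additive and locally bounded, hence [F t = t F 1]. As [alpha r (G v)] vanishes when
    [r -> 0], the limit of [alpha t v / t] is [F 1]. *)

(** * Linear combinations *)

(** The operator [B] is neither bounded nor assumed closed, so it cannot be moved across an integral
    or a limit, and the definition of the iterates gives neither their strong continuity nor that
    [int_0^t V_n v] lies in the domain of [A]. Both are drawn from one scalar quantity, the mass
    loss [Psi y - Psi (U h y)] for [y] in the cone: it bounds all iterates of index at least 1 at
    time [h], uniformly in the index, and tends to 0 with [h]. Writing a vector as a difference of
    positive ones carries such bounds to the whole space.

    Product formulas for infinite sums use positivity in place of absolute convergence: the square
    of size [n] contains the triangle of size [n] and is contained in the triangle of size [2n], and
    the cone is closed.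

    The telescoped partial sums keep a nonnegative remainder [Psi (B (int_0^t V_n v))], which is
    dropped and not shown to vanish; this is why a-hat is only compared with [a_0] by an inequality.
    Evaluating [F] at time 1 yields the bound [M (|v| + |G v|)], well inside the constant [4 M]. *)

Inductive vexpr :=
  | VVar (n : nat) | VZero | VPlus (a b : vexpr) | VOpp (a : vexpr)
  | VScal (r : R) (a : vexpr).

Fixpoint vcoef (e : vexpr) (i : nat) : R :=
  match e with
  | VVar n => if Nat.eqb n i then 1 else 0
  | VZero => 0
  | VPlus a b => vcoef a i + vcoef b i
  | VOpp a => - vcoef a i
  | VScal r a => r * vcoef a i
  end.

Section VectorSolver.
Context {X : NormedModule R_AbsRing}.

Fixpoint vdenote (env : list X) (e : vexpr) : X :=
  match e with
  | VVar n => nth n env zero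
  | VZero => zero
  | VPlus a b => plus (vdenote env a) (vdenote env b)
  | VOpp a => opp (vdenote env a)
  | VScal r a => scal r (vdenote env a)
  end.

Fixpoint lincomb (c : nat -> R) (env : list X) : X :=
  match env with
  | nil => zero
  | x :: l => plus (scal (c 0%nat) x) (lincomb (fun n => c (S n)) l)
  end.

(** Defined by recursion and not by a bounded quantifier, so that on a concrete list of atoms [cbn]
    unfolds it into a conjunction of real equations for [ring] and [field]. *)
Fixpoint same_coefs (c d : nat -> R) (n : nat) : Prop :=
  match n with
  | 0%nat => True
  | S m => c 0%nat = d 0%nat /\ same_coefs (fun i => c (S i)) (fun i => d (S i)) m
  end.

Lemma scal_R0 (x : X) : scal (0 : R) x = zero.
Proof. exact (scal_zero_l x). Qed.

Lemma scal_R1 (x : X) : scal (1 : R) x = x.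
Proof. exact (scal_one x). Qed.

Lemma lincomb_ext (c d : nat -> R) (env : list X) :
  same_coefs c d (length env) -> lincomb c env = lincomb d env.
Proof.
elim: env c d => [//|x l IH] c d /= [H0 H].
by rewrite H0 (IH _ _ H).
Qed.

Lemma lincomb_zero (env : list X) : lincomb (fun _ => 0) env = zero.
Proof. elim: env => [//|x l IH] /=. by rewrite IH scal_R0 plus_zero_l. Qed.

Lemma lincomb_var (n : nat) (env : list X) :
  lincomb (fun i => if Nat.eqb n i then 1 else 0) env = nth n env zero.
Proof.
elim: env n => [|x l IH] [|n] //=.
- rewrite scal_R1. have := lincomb_zero l => /= ->. by rewrite plus_zero_r.
- by rewrite IH scal_R0 plus_zero_l.
Qed.

Lemma lincomb_plus (c d : nat -> R) (env : list X) :
  lincomb (fun i => c i + d i) env = plus (lincomb c env) (lincomb d env).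
Proof.
elim: env c d => [|x l IH] c d /=; first by rewrite plus_zero_l.
rewrite (IH (fun n => c (S n)) (fun n => d (S n))).
have -> : scal (c 0%nat + d 0%nat) x = plus (scal (c 0%nat) x) (scal (d 0%nat) x)
  by exact (scal_distr_r (c 0%nat) (d 0%nat) x).
rewrite -!plus_assoc; f_equal. rewrite !plus_assoc; f_equal. by rewrite plus_comm.
Qed.

Lemma lincomb_scal (r : R) (c : nat -> R) (env : list X) :
  lincomb (fun i => r * c i) env = scal r (lincomb c env).
Proof.
elim: env c => [|x l IH] c /=; first by rewrite scal_zero_r.
rewrite (IH (fun n => c (S n))).
have -> : scal (r * c 0%nat) x = scal r (scal (c 0%nat) x)
  by rewrite scal_assoc.
by rewrite scal_distr_l.
Qed.

Lemma lincomb_opp (c : nat -> R) (env : list X) :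
  lincomb (fun i => - c i) env = opp (lincomb c env).
Proof.
elim: env c => [|x l IH] c /=; first by rewrite opp_zero.
rewrite (IH (fun n => c (S n))) opp_plus; f_equal.
exact (scal_opp_l (c 0%nat) x).
Qed.

Lemma vdenote_lincomb (env : list X) (e : vexpr) :
  vdenote env e = lincomb (vcoef e) env.
Proof.
elim: e => [n||a IHa b IHb|a IHa|r a IHa] /=.
- by rewrite lincomb_var.
- by rewrite lincomb_zero.
- by rewrite IHa IHb lincomb_plus.
- by rewrite IHa -lincomb_opp.
- by rewrite IHa lincomb_scal.
Qed.

Lemma vdenote_eq (env : list X) (e1 e2 : vexpr) :
  same_coefs (vcoef e1) (vcoef e2) (length env) -> vdenote env e1 = vdenote env e2.
Proof. move=> H. rewrite !vdenote_lincomb. exact: lincomb_ext. Qed.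

End VectorSolver.

Ltac v_index x env :=
  lazymatch env with
  | cons x _ => constr:(0%nat)
  | cons _ ?l => let n := v_index x l in constr:(S n)
  end.

Ltac v_add x env :=
  lazymatch env with
  | nil => constr:(cons x nil)
  | cons x _ => env
  | cons ?y ?l => let l' := v_add x l in constr:(cons y l')
  end.

Ltac v_atoms t env :=
  lazymatch t with
  | plus ?a ?b => let e := v_atoms a env in v_atoms b e
  | minus ?a ?b => let e := v_atoms a env in v_atoms b e
  | opp ?a => v_atoms a env
  | scal _ ?a => v_atoms a env
  | zero => env
  | _ => v_add t env
  end.

Ltac v_reify t env :=
  lazymatch t with
  | plus ?a ?b =>
    let a' := v_reify a env in let b' := v_reify b env in constr:(VPlus a' b')
  | minus ?a ?b =>
    let a' := v_reify a env in let b' := v_reify b env in constr:(VPlus a' (VOpp b'))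
  | opp ?a => let a' := v_reify a env in constr:(VOpp a')
  | scal ?r ?a => let a' := v_reify a env in constr:(VScal r a')
  | zero => constr:(VZero)
  | _ => let n := v_index t env in constr:(VVar n)
  end.

(* Decides identities of linear combinations in a normed module over [R], leaving
   only the equations between coefficients that [field] cannot close by itself. *)
Ltac vsolve :=
  lazymatch goal with
  | |- @eq ?T ?a ?b =>
    let e0 := constr:(@nil T) in
    let e1 := v_atoms a e0 in
    let env := v_atoms b e1 in
    let a' := v_reify a env in
    let b' := v_reify b env in
    refine (@vdenote_eq _ env a' b' _);
    cbn [same_coefs vcoef length Nat.eqb]; repeat split; try ring; try field
  end.

(** * Limits, continuity and integrals of vector-valued functions *)

Notation lim0 f l := (filterlim f (at_right 0) (locally l)).

Section Linear.
Context {X Y : NormedModule R_AbsRing}.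

Lemma lin_opp (L : X -> Y) u : is_linear L -> L (opp u) = opp (L u).
Proof.
move=> HL. have -> : opp u = scal (-1) u by vsolve.
rewrite (linear_scal _ HL). vsolve.
Qed.

Lemma lin_minus (L : X -> Y) u v :
  is_linear L -> L (minus u v) = minus (L u) (L v).
Proof. move=> HL. by rewrite /minus (linear_plus _ HL) lin_opp. Qed.

Lemma lin_zero (L : X -> Y) : is_linear L -> L zero = zero.
Proof.
move=> HL. have -> : (zero : X) = scal 0 zero by vsolve.
rewrite (linear_scal _ HL). vsolve.
Qed.

Lemma lin_sum (L : X -> Y) (f : nat -> X) n :
  is_linear L -> L (sum_n f n) = sum_n (fun k => L (f k)) n.
Proof.
move=> HL. elim: n => [|n IH]; first by rewrite !sum_O.
by rewrite !sum_Sn (linear_plus _ HL) IH.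
Qed.

Lemma norm_zero_eq (x : X) : norm x <= 0 -> x = zero.
Proof.
move=> H. apply: norm_eq_zero. have := norm_ge_0 x. rewrite /=; lra.
Qed.

Lemma norm_minus_le (x y : X) : norm (minus x y) <= norm x + norm y.
Proof.
apply: Rle_trans; first exact: norm_triangle. rewrite norm_opp. lra.
Qed.

Lemma norm_minus_sym (x y : X) : norm (minus x y) = norm (minus y x).
Proof. rewrite -norm_opp. f_equal. vsolve. Qed.

End Linear.

Section FilterLimits.
Context {X Y : NormedModule R_AbsRing} {T : Type}.
Variable F : (T -> Prop) -> Prop.
Context {FF : Filter F}.

Lemma fl_norm (f : T -> X) (a : X) :
  filterlim f F (locally a) <->
  forall eps, 0 < eps -> F (fun t => norm (minus (f t) a) < eps).
Proof.
rewrite filterlim_locally_ball_norm. split.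
- move=> H eps He. exact: (H (mkposreal eps He)).
- move=> H eps. exact: H (cond_pos eps).
Qed.

Lemma fl_plus (f g : T -> X) (a b : X) :
  filterlim f F (locally a) -> filterlim g F (locally b) ->
  filterlim (fun t => plus (f t) (g t)) F (locally (plus a b)).
Proof.
move=> Hf Hg. apply: (filterlim_comp_2 _ _ _ Hf Hg). exact: filterlim_plus.
Qed.

Lemma fl_opp (f : T -> X) (a : X) :
  filterlim f F (locally a) -> filterlim (fun t => opp (f t)) F (locally (opp a)).
Proof. move=> Hf. apply: (filterlim_comp _ _ _ _ _ _ _ _ Hf). exact: filterlim_opp. Qed.

Lemma fl_minus (f g : T -> X) (a b : X) :
  filterlim f F (locally a) -> filterlim g F (locally b) ->
  filterlim (fun t => minus (f t) (g t)) F (locally (minus a b)).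
Proof. move=> Hf Hg. apply: fl_plus => //. exact: fl_opp. Qed.

Lemma fl_squeeze (f : T -> X) (a : X) (r : T -> R) :
  F (fun t => norm (minus (f t) a) <= r t) ->
  filterlim r F (locally 0) -> filterlim f F (locally a).
Proof.
move=> H Hr. apply/fl_norm => eps He.
have /filterlim_locally_ball_norm /(_ (mkposreal eps He)) Hr' := Hr.
apply: filter_imp (filter_and _ _ H Hr') => t [H1 H2].
apply: Rle_lt_trans H1 _. move: H2. rewrite /ball_norm /=.
change (norm (minus (r t) 0)) with (Rabs (r t - 0)).
move=> /Rabs_lt_between; lra.
Qed.

Lemma fl_lin (L : X -> Y) (f : T -> X) (a : X) :
  is_linear L -> filterlim f F (locally a) ->
  filterlim (fun t => L (f t)) F (locally (L a)).
Proof. move=> HL Hf. apply: filterlim_comp Hf _. exact: linear_cont HL. Qed.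

End FilterLimits.

Section FilterSums.
Context {X Y : NormedModule R_AbsRing} {T : Type}.
Variable F : (T -> Prop) -> Prop.
Context {FF : Filter F}.

Lemma fl_scal (c : R) (f : T -> X) (a : X) :
  filterlim f F (locally a) ->
  filterlim (fun t => scal c (f t)) F (locally (scal c a)).
Proof.
move=> Hf. apply: (filterlim_comp _ _ _ _ _ _ _ _ Hf).
exact: filterlim_scal_r.
Qed.

Lemma fl_norm0 (f : T -> X) (a : X) :
  filterlim f F (locally a) ->
  filterlim (fun t => norm (minus (f t) a)) F (locally 0).
Proof.
move=> /fl_norm H. apply/(fl_norm (X := R_NormedModule)) => eps He.
apply: filter_imp (H eps He) => t Ht.
change (Rabs (norm (minus (f t) a) - 0) < eps).
rewrite Rminus_0_r Rabs_pos_eq //. exact: norm_ge_0.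
Qed.

Lemma fl_sum (f : nat -> T -> X) (a : nat -> X) n :
  (forall k, (k <= n)%nat -> filterlim (f k) F (locally (a k))) ->
  filterlim (fun t => sum_n (fun k => f k t) n) F (locally (sum_n a n)).
Proof.
elim: n => [|n IH] H.
- rewrite sum_O. apply: filterlim_ext (H 0%nat (le_n _)) => t. by rewrite sum_O.
- rewrite sum_Sn.
  apply: (filterlim_ext (fun t => plus (sum_n (fun k => f k t) n) (f (S n) t))).
    by move=> t; rewrite sum_Sn.
  apply: fl_plus; last exact: H. apply: IH => k Hk. apply: H. lia.
Qed.

End FilterSums.

Section FilterOperators.
Context {X Y : NormedModule R_AbsRing} {T : Type}.
Variable F : (T -> Prop) -> Prop.
Context {FF : Filter F}.

(** The uniform bound [K] controls [L t (y t - a)], so convergence at the fixed vector [a] suffices.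
    This yields joint continuity of operator families and diagonal limits such as that of
    [Wn n t (Wn n s y)]. *)
Lemma fl_family (L : T -> X -> Y) (K : R) (y : T -> X) (a : X) (b : Y) :
  F (fun t => is_linear (L t) /\ forall u, norm (L t u) <= K * norm u) ->
  filterlim y F (locally a) -> filterlim (fun t => L t a) F (locally b) ->
  filterlim (fun t => L t (y t)) F (locally b).
Proof.
move=> HL Hy Ha.
apply: (@fl_squeeze _ _ _ _ _ _
  (fun t => K * norm (minus (y t) a) + norm (minus (L t a) b))).
- apply: filter_imp HL => t [Hl Hb].
  have -> : minus (L t (y t)) b = plus (L t (minus (y t) a)) (minus (L t a) b).
    rewrite (lin_minus (L t)) //. vsolve.
  apply: Rle_trans; first exact: norm_triangle.
  apply: Rplus_le_compat_r. exact: Hb.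
- pose proof (fl_scal (X := R_NormedModule) F K _ _ (fl_norm0 F _ _ Hy)) as H1.
  pose proof (fl_plus (X := R_NormedModule) F _ _ _ _ H1 (fl_norm0 F _ _ Ha)) as H2.
  have E : plus (scal K 0) 0 = 0 :> R by rewrite /plus /scal /= /mult /=; ring.
  by rewrite E in H2.
Qed.

End FilterOperators.

Section RightLimits.
Context {X : NormedModule R_AbsRing}.

Lemma at_right_intro (P : R -> Prop) (d : R) :
  0 < d -> (forall h, 0 < h < d -> P h) -> at_right 0 P.
Proof.
move=> Hd H. exists (mkposreal d Hd) => h Hb H0. apply: H. split=> //.
move: Hb. rewrite /ball /= /AbsRing_ball /abs /minus /plus /opp /=.
move=> /Rabs_lt_between; lra.
Qed.

Lemma at_right_elim (P : R -> Prop) :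
  at_right 0 P -> exists d, 0 < d /\ forall h, 0 < h < d -> P h.
Proof.
move=> [d Hd]. exists d; split; first exact: cond_pos.
move=> h Hh. apply: Hd; last lra.
rewrite /ball /= /AbsRing_ball /abs /minus /plus /opp /=. apply: Rabs_def1; lra.
Qed.

Lemma at_right_pos (P : R -> Prop) : (forall h, 0 < h -> P h) -> at_right 0 P.
Proof. move=> H. apply: (at_right_intro _ 1); first lra. move=> h Hh; apply: H; lra. Qed.

Lemma lim0_norm (f : R -> X) (a : X) :
  lim0 f a <-> forall eps, 0 < eps -> exists d, 0 < d /\
    forall h, 0 < h < d -> norm (minus (f h) a) < eps.
Proof.
rewrite fl_norm; split=> H eps He.
- exact: at_right_elim (H eps He).
- case: (H eps He) => d [Hd Hh]. exact: at_right_intro Hd Hh.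
Qed.

Lemma lim0_ext (f g : R -> X) (a : X) :
  (forall h, 0 < h -> f h = g h) -> lim0 f a -> lim0 g a.
Proof. move=> H. apply: filterlim_ext_loc. exact: at_right_pos. Qed.

Lemma lim0_unique (f : R -> X) (a b : X) : lim0 f a -> lim0 f b -> a = b.
Proof.
move=> Ha Hb.
exact (filterlim_locally_unique (F := at_right 0)
  (FF := Proper_StrongProper _ (at_right_proper_filter 0)) f a b Ha Hb).
Qed.

Lemma lim0_le (f g : R -> R) (a b : R) :
  at_right 0 (fun h => f h <= g h) -> lim0 f a -> lim0 g b -> a <= b.
Proof.
move=> H Hf Hg. exact: (filterlim_le (F := at_right 0) f g (Finite a) (Finite b) H Hf Hg).
Qed.

End RightLimits.

Definition cont0 {X : NormedModule R_AbsRing} (f : R -> X) : Prop :=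
  forall t, 0 <= t -> filterlim f (within (fun s => 0 <= s) (locally t)) (locally (f t)).

Section Cont0.
Context {X Y : NormedModule R_AbsRing}.

Lemma cont0_norm (f : R -> X) :
  cont0 f <-> forall t, 0 <= t -> forall eps, 0 < eps -> exists d, 0 < d /\
    forall s, 0 <= s -> Rabs (s - t) < d -> norm (minus (f s) (f t)) < eps.
Proof.
split=> H t Ht.
- move=> eps He. have /fl_norm /(_ eps He) [d Hd] := H t Ht.
  exists d; split; first exact: cond_pos. move=> s Hs Hst. exact: Hd.
- apply/fl_norm => eps He. have [d [Hd Hs]] := H t Ht eps He.
  exists (mkposreal d Hd) => s Hb H0. exact: Hs.
Qed.

(** Since [d] does not depend on [t], a left increment at [t] is a right increment at the earlier
    point, with the same modulus. *)
Lemma cont0_modulus (f : R -> X) :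
  (forall eps, 0 < eps -> exists d, 0 < d /\
    forall t h, 0 <= t -> 0 < h < d -> norm (minus (f (t + h)) (f t)) < eps) ->
  cont0 f.
Proof.
move=> H. apply/cont0_norm => t Ht eps He.
have [d [Hd Hh]] := H eps He. exists d; split=> // s Hs Hst.
case: (Rtotal_order s t) => [Hlt|[->|Hgt]].
- rewrite norm_minus_sym. have -> : t = s + (t - s) by ring.
  apply: Hh => //. move: Hst => /Rabs_lt_between. lra.
- by rewrite minus_eq_zero norm_zero.
- have -> : s = t + (s - t) by ring.
  apply: Hh => //. move: Hst => /Rabs_lt_between. lra.
Qed.

Lemma cont0_comp (f : R -> X) (p : R -> R) :
  cont0 f -> (forall s, 0 <= p s) -> (forall s s', Rabs (p s - p s') <= Rabs (s - s')) ->
  forall t, continuous (fun s => f (p s)) t.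
Proof.
move=> /cont0_norm Hf Hp Hl t. apply/fl_norm => eps He.
have [d [Hd Hs]] := Hf (p t) (Hp t) eps He.
exists (mkposreal d Hd) => s Hb. apply: Hs => //.
apply: Rle_lt_trans (Hl s t) _. exact: Hb.
Qed.

Lemma cont0_plus (f g : R -> X) :
  cont0 f -> cont0 g -> cont0 (fun t => plus (f t) (g t)).
Proof. move=> Hf Hg t Ht. apply: fl_plus; [exact: Hf|exact: Hg]. Qed.

End Cont0.

Lemma cont0_lin {X Y : NormedModule R_AbsRing} (L : X -> Y) (f : R -> X) :
  is_linear L -> cont0 f -> cont0 (fun t => L (f t)).
Proof. move=> HL Hf t Ht. apply: fl_lin => //. exact: Hf. Qed.

Lemma Rmax0_lip s s' : Rabs (Rmax 0 s - Rmax 0 s') <= Rabs (s - s').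
Proof. rewrite /Rmax /Rabs. repeat case: Rle_dec => ?; repeat case: Rcase_abs => ?; lra. Qed.

Section Integrals.
Context {X : CompleteNormedModule R_AbsRing}.

Lemma ex_RInt_cont0 (f : R -> X) a b :
  cont0 f -> 0 <= a -> 0 <= b -> ex_RInt f a b.
Proof.
(* Freezing [f] at its value in 0 for negative times makes it continuous on the whole line. *)
move=> Hf Ha Hb. apply: (ex_RInt_ext (fun s => f (Rmax 0 s))).
- move=> s [Hs _]. rewrite Rmax_right //. move: Hs. rewrite /Rmin. case: Rle_dec; lra.
- apply: ex_RInt_continuous => s _. apply: cont0_comp Hf _ _ _.
  + move=> r; exact: Rmax_l.
  + exact: Rmax0_lip.
Qed.

Lemma Riemann_sum_lin {Y : NormedModule R_AbsRing} (L : X -> Y) (f : R -> X) ptd :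
  is_linear L -> Riemann_sum (fun s => L (f s)) ptd = L (Riemann_sum f ptd).
Proof.
move=> HL. elim/(@SF_cons_ind R): ptd => [x|h s IH].
- by rewrite /Riemann_sum /= lin_zero.
- by rewrite !Riemann_sum_cons IH (linear_plus _ HL) (linear_scal _ HL).
Qed.

Lemma is_RInt_lin {Y : NormedModule R_AbsRing} (L : X -> Y) (f : R -> X) a b l :
  is_linear L -> is_RInt f a b l -> is_RInt (fun s => L (f s)) a b (L l).
Proof.
move=> HL H. apply: filterlim_ext (fl_lin _ L _ _ HL H) => ptd.
by rewrite Riemann_sum_lin // (linear_scal _ HL).
Qed.

Lemma is_RInt_RInt (f : R -> X) a b :
  cont0 f -> 0 <= a -> 0 <= b -> is_RInt f a b (RInt f a b).
Proof. move=> *. apply: RInt_correct. exact: ex_RInt_cont0. Qed.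

Lemma RInt_lin (L : X -> X) (f : R -> X) a b :
  is_linear L -> cont0 f -> 0 <= a -> 0 <= b ->
  RInt (fun s => L (f s)) a b = L (RInt f a b).
Proof.
move=> HL Hf Ha Hb. apply: is_RInt_unique. apply: is_RInt_lin => //.
exact: is_RInt_RInt.
Qed.

Lemma is_RInt_shift (f : R -> X) a b s l :
  is_RInt f (a + s) (b + s) l -> is_RInt (fun r => f (r + s)) a b l.
Proof.
move=> H.
apply: (is_RInt_ext (fun r => scal 1 (f (1 * r + s)))).
  move=> r _. rewrite Rmult_1_l. vsolve.
apply: is_RInt_comp_lin. by rewrite !Rmult_1_l.
Qed.

Lemma is_RInt_cone (C : X -> Prop) (f : R -> X) a b l :
  closed C -> C zero -> (forall u v, C u -> C v -> C (plus u v)) ->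
  (forall r u, 0 <= r -> C u -> C (scal r u)) ->
  a <= b -> (forall s, a <= s <= b -> C (f s)) -> is_RInt f a b l -> C l.
Proof.
move=> Hc H0 Hp Hs Hab Hf Hi.
(* Clamping the argument puts every value of [g] in [C], so the position of the tags of a
   subdivision need not be tracked; each Riemann sum is then a nonnegative combination of elements
   of [C]. *)
pose g s := f (Rmax a (Rmin b s)).
have Hg : forall s, C (g s).
  move=> s. apply: Hf. split; first exact: Rmax_l.
  apply: Rmax_lub => //. exact: Rmin_l.
have {}Hi : is_RInt g a b l.
  apply: is_RInt_ext Hi => s. rewrite /g Rmin_left // Rmax_right // => ?.
  rewrite Rmin_right ?Rmax_right //; lra.
apply: (closed_filterlim_loc _ C _ Hi) => //.
exists (mkposreal 1 Rlt_0_1) => ptd _ [Hptd _].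
apply: (Hs).
  case: (Rle_lt_or_eq_dec _ _ Hab) => [?|->].
  - rewrite sign_eq_1; lra.
  - rewrite Rminus_eq_0 sign_0; lra.
elim/(@SF_cons_ind R): ptd Hptd => [x|h s IH] Hptd.
- by rewrite /Riemann_sum.
- rewrite Riemann_sum_cons. apply: (Hp).
  + apply: (Hs) => //. have := ptd_sort _ Hptd. case=> /= H1 _. lra.
  + apply: IH. exact: ptd_cons Hptd.
Qed.

Lemma RInt_plus_mid (f : R -> X) a b c :
  cont0 f -> 0 <= a -> 0 <= b -> 0 <= c ->
  plus (RInt f a b) (RInt f b c) = RInt f a c.
Proof. move=> *. apply: RInt_Chasles; exact: ex_RInt_cont0. Qed.

Lemma RInt_norm_le (f : R -> X) a b K :
  cont0 f -> 0 <= a -> a <= b -> (forall s, a <= s <= b -> norm (f s) <= K) ->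
  norm (RInt f a b) <= (b - a) * K.
Proof.
move=> Hf Ha Hab HK. apply: (norm_RInt_le_const f) => //.
apply: is_RInt_RInt => //; lra.
Qed.

Lemma is_RInt_mean (f : R -> X) (l y : X) h eps :
  0 < h -> (forall s, 0 <= s <= h -> norm (minus (f s) y) <= eps) ->
  is_RInt f 0 h l -> norm (minus (scal (/ h) l) y) <= eps.
Proof.
move=> Hh Hf Hi.
have Hc : is_RInt (fun _ => y) 0 h (scal (h - 0) y) by exact: is_RInt_const.
have Hm := is_RInt_minus _ _ _ _ _ _ Hi Hc.
have Hn := norm_RInt_le_const _ _ _ _ eps (Rlt_le _ _ Hh) Hf Hm.
have -> : minus (scal (/ h) l) y = scal (/ h) (minus l (scal (h - 0) y)).
  vsolve; lra.
apply: Rle_trans; first exact: norm_scal.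
have -> : @abs R_AbsRing (/ h) = / h.
  apply: Rabs_pos_eq. left. exact: Rinv_0_lt_compat.
apply: (Rmult_le_reg_l h) => //. rewrite -Rmult_assoc Rinv_r; last lra. rewrite Rmult_1_l. apply: Rle_trans Hn _; lra.
Qed.

Lemma ftc_right (f : R -> X) t :
  cont0 f -> 0 <= t -> lim0 (fun h => scal (/ h) (RInt f t (t + h))) (f t).
Proof.
move=> Hf Ht. apply/lim0_norm => eps He.
have [d [Hd Hs]] := proj1 (cont0_norm f) Hf t Ht (eps / 2) ltac:(lra).
exists d; split=> // h Hh. apply: (Rle_lt_trans _ (eps / 2)); last lra.
apply: (is_RInt_mean (fun s => f (s + t))); first lra.
- move=> s Hsh. left. apply: Hs; first lra. apply: Rabs_def1; lra.
- apply: is_RInt_shift. rewrite Rplus_0_l Rplus_comm. apply: is_RInt_RInt => //; lra.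
Qed.

End Integrals.

(** * Generators of semigroups *)

(** The part of a semigroup's structure that orbit integrals need. It is isolated because the
    Dyson-Phillips iterates of positive index have it without being semigroups. *)
Record bounded_family {X : CompleteNormedModule R_AbsRing}
    (K : R) (T : R -> X -> X) : Prop := {
  family_lin : forall t, 0 <= t -> is_linear (T t);
  family_bound : forall t u, 0 <= t -> norm (T t u) <= K * norm u;
  family_cont : forall u, cont0 (fun t => T t u)
}.

Definition orbit_int {X : CompleteNormedModule R_AbsRing}
  (T : R -> X -> X) (t : R) (y : X) : X := RInt (fun s => T s y) 0 t.

Section Family.
Context {X : CompleteNormedModule R_AbsRing}.
Variables (K : R) (T : R -> X -> X).
Hypothesis HT : bounded_family K T.

Lemma family_moving {I : Type} (F : (I -> Prop) -> Prop) {FF : Filter F}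
    (p : I -> R) (y : I -> X) (p0 : R) (y0 : X) :
  0 <= p0 -> F (fun i => 0 <= p i) ->
  filterlim p F (locally p0) -> filterlim y F (locally y0) ->
  filterlim (fun i => T (p i) (y i)) F (locally (T p0 y0)).
Proof.
move=> Hp0 Hp Hl Hy. apply: (fl_family F (fun i => T (p i)) K y y0) => //.
- apply: filter_imp Hp => i Hi. split; first exact: (family_lin _ _ HT).
  move=> u. exact: (family_bound _ _ HT).
- apply: filterlim_comp (family_cont _ _ HT y0 _ Hp0).
  move=> P HP. rewrite /filtermap.
  apply: filter_imp (filter_and _ _ Hp (Hl _ HP)) => i [H1 H2]. exact: H2.
Qed.

Lemma family_cont0 (p : R -> R) (y : R -> X) :
  (forall t, 0 <= t -> 0 <= p t) -> (forall t s, Rabs (p t - p s) <= Rabs (t - s)) ->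
  cont0 y -> cont0 (fun t => T (p t) (y t)).
Proof.
move=> Hp Hl Hy t Ht. apply: family_moving; first exact: Hp.
- exists (mkposreal 1 Rlt_0_1) => s _ Hs. exact: Hp.
- move=> P [d Hd]. exists d => s Hs _. apply: Hd.
  apply: Rle_lt_trans (Hl s t) _. exact: Hs.
- exact: Hy.
Qed.

Lemma orbit_RInt t y :
  0 <= t -> is_RInt (fun s => T s y) 0 t (orbit_int T t y).
Proof. move=> Ht. apply: is_RInt_RInt => //; [exact: (family_cont _ _ HT)|lra]. Qed.

Lemma orbit_int_plus t y z :
  0 <= t -> orbit_int T t (plus y z) = plus (orbit_int T t y) (orbit_int T t z).
Proof.
move=> Ht. apply: is_RInt_unique.
apply: (is_RInt_ext (fun s => plus (T s y) (T s z))).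
- move=> s [Hs _]. rewrite Rmin_left // in Hs.
  by rewrite (linear_plus _ (family_lin _ _ HT s (Rlt_le _ _ Hs))).
- apply: is_RInt_plus; exact: orbit_RInt.
Qed.

Lemma orbit_int_scal t c y :
  0 <= t -> orbit_int T t (scal c y) = scal c (orbit_int T t y).
Proof.
move=> Ht. apply: is_RInt_unique.
apply: (is_RInt_ext (fun s => scal c (T s y))).
- move=> s [Hs _]. rewrite Rmin_left // in Hs.
  by rewrite (linear_scal _ (family_lin _ _ HT s (Rlt_le _ _ Hs))).
- apply: is_RInt_scal; exact: orbit_RInt.
Qed.

Lemma orbit_int_norm t y : 0 <= t -> norm (orbit_int T t y) <= t * (K * norm y).
Proof.
move=> Ht. have -> : t * (K * norm y) = (t - 0) * (K * norm y) by ring.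
apply: RInt_norm_le => //; first exact: (family_cont _ _ HT); first lra.
move=> s Hs. apply: (family_bound _ _ HT). lra.
Qed.

Lemma orbit_int_lin t : 0 <= K -> 0 <= t -> is_linear (orbit_int T t).
Proof.
move=> HK Ht. split.
- move=> x y. exact: orbit_int_plus.
- move=> c x. exact: orbit_int_scal.
- exists (t * K + 1). split; first by nra.
  move=> x. have := orbit_int_norm t x Ht. have := norm_ge_0 x. rewrite /=; nra.
Qed.

Lemma orbit_int_split t h y :
  0 <= t -> 0 <= h ->
  orbit_int T (t + h) y = plus (orbit_int T t y) (RInt (fun r => T r y) t (t + h)).
Proof.
move=> Ht Hh. rewrite /orbit_int RInt_plus_mid //; try lra. exact: (family_cont _ _ HT).
Qed.

Lemma orbit_mean y : lim0 (fun h => scal (/ h) (orbit_int T h y)) (T 0 y).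
Proof.
apply: lim0_ext (ftc_right _ _ (family_cont _ _ HT y) (Rle_refl 0)) => h Hh.
by rewrite Rplus_0_l.
Qed.

End Family.

Section Generator.
Context {X : CompleteNormedModule R_AbsRing}.
Variables (K : R) (T : R -> X -> X) (A : operator X).
Hypothesis HK : 0 <= K.
Hypothesis HT : C0_semigroup T.
Hypothesis HTK : forall t u, 0 <= t -> norm (T t u) <= K * norm u.
Hypothesis HA : is_generator T A.

Lemma semigroup_comm s t u : 0 <= s -> 0 <= t -> T s (T t u) = T t (T s u).
Proof. move=> Hs Ht. by rewrite -!(semigroup_plus HT) // Rplus_comm. Qed.

Lemma semigroup_family : bounded_family K T.
Proof.
split=> //; first exact: (semigroup_bounded HT).
move=> u. apply: cont0_modulus => eps He.
(* [K + 1] and not [K], which may be 0. *)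
have He' : 0 < eps / (K + 1) by apply: Rdiv_lt_0_compat; lra.
have [d [Hd Hh]] := proj1 (lim0_norm _ _) (@semigroup_cont X T HT u) _ He'.
exists d; split=> // t h Ht Hhd.
rewrite (semigroup_plus HT) //; last lra.
rewrite -(lin_minus (T t)); last exact: (semigroup_bounded HT).
apply: Rle_lt_trans; first exact: HTK.
have {Hh Hhd} := Hh h Hhd. have := norm_ge_0 (minus (T h u) u).
set n := norm _ => Hn Hlt.
have : (K + 1) * n < (K + 1) * (eps / (K + 1)) by apply: Rmult_lt_compat_l; lra.
have -> : (K + 1) * (eps / (K + 1)) = eps by field; lra.
lra.
Qed.
Let HF := semigroup_family.

Lemma generator_lim u :
  dom A u -> lim0 (fun t => scal (/ t) (minus (T t u) u)) (A u).
Proof. move=> Hu. by apply/HA. Qed.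

Lemma generator_intro u w :
  lim0 (fun t => scal (/ t) (minus (T t u) u)) w -> dom A u /\ A u = w.
Proof. by move/HA. Qed.

Lemma generator_plus u v :
  dom A u -> dom A v -> dom A (plus u v) /\ A (plus u v) = plus (A u) (A v).
Proof.
move=> /generator_lim Hu /generator_lim Hv. apply: generator_intro.
apply: lim0_ext (fl_plus _ _ _ _ _ Hu Hv) => h Hh.
rewrite (linear_plus _ (semigroup_bounded HT (Rlt_le _ _ Hh))). vsolve; lra.
Qed.

Lemma generator_scal c u :
  dom A u -> dom A (scal c u) /\ A (scal c u) = scal c (A u).
Proof.
move=> /generator_lim Hu. apply: generator_intro.
apply: lim0_ext (fl_scal _ c _ _ Hu) => h Hh.
rewrite (linear_scal _ (semigroup_bounded HT (Rlt_le _ _ Hh))). vsolve; lra.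
Qed.

Lemma semigroup_orbit_int t h y : 0 <= t -> 0 <= h ->
  T h (orbit_int T t y) = RInt (fun s => T s y) h (t + h).
Proof.
move=> Ht Hh. rewrite /orbit_int -(RInt_lin (T h)) //; last lra.
- apply: is_RInt_unique. apply: (is_RInt_ext (fun s => T (s + h) y)).
    move=> s [Hs _]. rewrite Rmin_left // in Hs.
    rewrite Rplus_comm (semigroup_plus HT) //. lra.
  apply: (is_RInt_shift (fun s => T s y)). rewrite Rplus_0_l. apply: is_RInt_RInt; try lra.
  exact: (family_cont _ _ HF).
- exact: (semigroup_bounded HT).
- exact: (family_cont _ _ HF).
Qed.

Lemma orbit_int_comm t h y : 0 <= t -> 0 <= h ->
  T h (orbit_int T t y) = orbit_int T t (T h y).
Proof.
move=> Ht Hh. rewrite /orbit_int -(RInt_lin (T h)) //; last lra.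
- apply: RInt_ext => s [Hs _]. rewrite Rmin_left // in Hs.
  apply: semigroup_comm => //. lra.
- exact: (semigroup_bounded HT).
- exact: (family_cont _ _ HF).
Qed.

(** [T h] shifts the interval of integration to [[h, t + h]], so the difference quotient is the mean
    of the orbit over [[t, t + h]] minus its mean over [[0, h]]. *)
Lemma generator_orbit_int t y : 0 <= t ->
  dom A (orbit_int T t y) /\ A (orbit_int T t y) = minus (T t y) y.
Proof.
move=> Ht. apply: generator_intro.
have Hc := family_cont _ _ HF y.
have H1 := ftc_right _ _ Hc Ht. have H0 := ftc_right _ _ Hc (Rle_refl 0).
rewrite (semigroup_zero HT) in H0.
apply: lim0_ext (fl_minus _ _ _ _ _ H1 H0) => h Hh.
rewrite semigroup_orbit_int //; last lra.
have Ea : RInt (fun s => T s y) h (t + h) =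
  minus (RInt (fun s => T s y) 0 (t + h)) (RInt (fun s => T s y) 0 h).
  rewrite -(RInt_plus_mid _ 0 h (t + h)) //; try lra. vsolve.
rewrite Ea /orbit_int -(RInt_plus_mid _ 0 t (t + h)) //; try lra.
rewrite Rplus_0_l. vsolve; lra.
Qed.

Lemma generator_comm t u : 0 <= t -> dom A u ->
  dom A (T t u) /\ A (T t u) = T t (A u).
Proof.
move=> Ht Hu. apply: generator_intro.
have HL := semigroup_bounded HT Ht.
apply: lim0_ext (fl_lin _ (T t) _ _ HL (generator_lim u Hu)) => h Hh.
rewrite (linear_scal _ HL) (lin_minus (T t)) // (semigroup_comm t h) //. lra.
Qed.

(** No orbit is differentiated: the bounded operator [orbit_int T t] is applied to the difference
    quotients of [u]. It commutes with [T h], so these become the difference quotients of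
    [orbit_int T t u], whose limit is known. *)
Lemma orbit_int_generator t u : 0 <= t -> dom A u ->
  orbit_int T t (A u) = minus (T t u) u.
Proof.
move=> Ht Hu. have [Hd <-] := generator_orbit_int t u Ht.
have HL := orbit_int_lin _ _ HF t HK Ht.
apply: (lim0_unique (X := X) _ _ _ (fl_lin _ (orbit_int T t) _ _ HL (generator_lim u Hu))).
apply: lim0_ext (generator_lim _ Hd) => h Hh.
rewrite (linear_scal _ HL) (lin_minus (orbit_int T t)) // orbit_int_comm //. lra.
Qed.

Lemma generator_approx y : lim0 (fun h => scal (/ h) (orbit_int T h y)) y.
Proof. have := orbit_mean _ _ HF y. by rewrite (semigroup_zero HT). Qed.

Lemma generator_approx_dom h y :
  0 < h -> dom A (scal (/ h) (orbit_int T h y)).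
Proof.
move=> Hh. apply: (proj1 (generator_scal _ _ _)).
apply: (proj1 (generator_orbit_int _ _ _)). lra.
Qed.

(** The means of the orbit of [y] over [[0, h]] lie in the domain and tend to [y]; density is used
    in this explicit form because the same means also stay in the cone when [y] does. *)
Lemma generator_dense_eq {Y : NormedModule R_AbsRing} (L1 L2 : X -> Y) y :
  is_linear L1 -> is_linear L2 -> (forall u, dom A u -> L1 u = L2 u) -> L1 y = L2 y.
Proof.
move=> H1 H2 H.
apply: (lim0_unique (X := Y) _ _ _ (fl_lin _ L1 _ _ H1 (generator_approx y))).
apply: lim0_ext (fl_lin _ L2 _ _ H2 (generator_approx y)) => h Hh.
rewrite H //. exact: generator_approx_dom.
Qed.

Lemma generator_right_deriv s u : 0 <= s -> dom A u ->
  lim0 (fun h => scal (/ h) (minus (T (s + h) u) (T s u))) (T s (A u)).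
Proof.
move=> Hs Hu. have HL := semigroup_bounded HT Hs.
apply: lim0_ext (fl_lin _ (T s) _ _ HL (generator_lim u Hu)) => h Hh.
rewrite (linear_scal _ HL) (lin_minus (T s)) // (semigroup_plus HT) //. lra.
Qed.

End Generator.

(** Turns mass estimates into continuity: the increments of [f] are controlled by those of a scalar
    mass [q]. *)
Lemma cont0_dominated {X : NormedModule R_AbsRing} (f : R -> X) (q : R -> R) :
  cont0 (X := R_NormedModule) q ->
  (forall t s, 0 <= t <= s -> norm (minus (f s) (f t)) <= Rabs (q s - q t)) ->
  cont0 f.
Proof.
move=> /cont0_norm Hq H. apply/cont0_norm => t Ht eps He.
have [d [Hd Hs]] := Hq t Ht eps He. exists d; split=> // s H0 Hst.
have H1 : Rabs (q s - q t) < eps by exact: Hs.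
case: (Rle_dec t s) => Hts.
- apply: Rle_lt_trans H1. apply: H. lra.
- rewrite norm_minus_sym. apply: Rle_lt_trans H1. rewrite Rabs_minus_sym. apply: H. lra.
Qed.

(** * Finite sums, triangles and squares of double sums *)

Lemma sum_n_shift {G : AbelianMonoid} (f : nat -> G) n :
  sum_n f (S n) = plus (f 0%nat) (sum_n (fun k => f (S k)) n).
Proof.
elim: n => [|n IH]; first by rewrite sum_Sn !sum_O.
by rewrite sum_Sn IH (sum_Sn (fun k => f (S k))) plus_assoc.
Qed.

Lemma sum_n_closed {G : AbelianMonoid} (P : G -> Prop) (f : nat -> G) n :
  (forall u v, P u -> P v -> P (plus u v)) ->
  (forall k, (k <= n)%nat -> P (f k)) -> P (sum_n f n).
Proof.
move=> Hp. elim: n => [|n IH] H; first by rewrite sum_O; apply: H.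
rewrite sum_Sn. apply: (Hp); [apply: IH => k Hk|]; apply: H; lia.
Qed.

Lemma is_linear_sum {X Y : NormedModule R_AbsRing} (L : nat -> X -> Y) n :
  (forall k, is_linear (L k)) -> is_linear (fun u => sum_n (fun k => L k u) n).
Proof.
move=> H. elim: n => [|n IH].
- have [H1 H2 [K [H3 H4]]] := H 0%nat.
  split; [move=> u v|move=> c u|exists K; split=> // u]; rewrite ?sum_O //.
- have [H1 H2 [K1 [H3 H4]]] := IH. have [H5 H6 [K2 [H7 H8]]] := H (S n).
  split.
  + move=> u v. rewrite !sum_Sn H1 H5. vsolve.
  + move=> c u. rewrite !sum_Sn H2 H6. vsolve.
  + exists (K1 + K2). split; first lra. move=> u. rewrite sum_Sn.
    apply: Rle_trans; first exact: norm_triangle.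
    rewrite Rmult_plus_distr_r. apply: Rplus_le_compat; [exact: H4|exact: H8].
Qed.

Lemma is_RInt_sum_n {X : NormedModule R_AbsRing} (f : nat -> R -> X) (l : nat -> X) a b n :
  (forall k, is_RInt (f k) a b (l k)) ->
  is_RInt (fun s => sum_n (fun k => f k s) n) a b (sum_n l n).
Proof.
move=> H. elim: n => [|n IH].
- rewrite sum_O. apply: is_RInt_ext (H 0%nat) => s _. by rewrite sum_O.
- rewrite sum_Sn. apply: is_RInt_ext (is_RInt_plus _ _ _ _ _ _ IH (H (S n))) => s _.
  by rewrite sum_Sn.
Qed.

Lemma norm_sum_n_le {X : NormedModule R_AbsRing} (f : nat -> X) c n :
  (forall k, (k <= n)%nat -> norm (f k) <= c) -> norm (sum_n f n) <= (INR n + 1) * c.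
Proof.
elim: n => [|n IH] H.
- rewrite sum_O /=. rewrite Rplus_0_l Rmult_1_l. exact: H.
- rewrite sum_Sn S_INR Rmult_plus_distr_r Rmult_1_l.
  apply: Rle_trans; first exact: norm_triangle.
  apply: Rplus_le_compat; last exact: H. apply: IH => k Hk. apply: H. lia.
Qed.

Lemma sum_n_head {G : AbelianMonoid} (x : nat -> G) n :
  sum_n (fun j => match j with 0%nat => x j | S _ => zero end) n = x 0%nat.
Proof.
elim: n => [|n IH]; first by rewrite sum_O.
by rewrite sum_Sn IH plus_zero_r.
Qed.

Lemma lim_norm_le {X : NormedModule R_AbsRing} {I : Type} (F : (I -> Prop) -> Prop)
    {FF : ProperFilter F} (f : I -> X) (l y : X) K :
  filterlim f F (locally l) -> F (fun i => norm (minus (f i) y) <= K) ->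
  norm (minus l y) <= K.
Proof.
move=> Hl HK. apply: le_epsilon => eps He.
have /fl_norm /(_ eps He) H := Hl.
have [i [H1 H2]] := filter_ex _ (filter_and _ _ H HK).
have -> : minus l y = plus (minus (f i) y) (opp (minus (f i) l)) by vsolve.
apply: Rle_trans; first exact: norm_triangle. rewrite norm_opp.
apply: Rplus_le_compat => //. by left.
Qed.

Lemma sum_n_minus {X : NormedModule R_AbsRing} (f g : nat -> X) n :
  sum_n (fun k => minus (f k) (g k)) n = minus (sum_n f n) (sum_n g n).
Proof.
elim: n => [|n IH]; first by rewrite !sum_O. rewrite !sum_Sn IH. vsolve.
Qed.

Lemma triangle_rows {G : AbelianMonoid} (c : nat -> nat -> G) n :
  sum_n (fun m => sum_n (fun k => c k (m - k)%nat) m) n =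
  sum_n (fun k => sum_n (c k) (n - k)) n.
Proof.
elim: n => [|n IH]; first by rewrite !sum_O.
rewrite sum_Sn IH (sum_Sn (fun k => sum_n (c k) (S n - k))) Nat.sub_diag sum_O.
rewrite (sum_n_ext_loc (fun k => sum_n (c k) (S n - k))
  (fun k => plus (sum_n (c k) (n - k)) (c k (S n - k)%nat))); last first.
  move=> k Hk. by rewrite Nat.sub_succ_l // sum_Sn.
rewrite sum_n_plus (sum_Sn (fun k => c k (S n - k)%nat)) Nat.sub_diag.
by rewrite plus_assoc.
Qed.

Section TriangleSquare.
Context {X : NormedModule R_AbsRing} (P : X -> Prop).
Hypothesis P_zero : P zero.
Hypothesis P_plus : forall u v, P u -> P v -> P (plus u v).

Lemma sum_n_mono (f : nat -> X) n m :
  (forall k, P (f k)) -> (n <= m)%nat -> P (minus (sum_n f m) (sum_n f n)).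
Proof.
move=> Hf. elim=> [|k Hk IH]; first by rewrite minus_eq_zero.
have -> : minus (sum_n f (S k)) (sum_n f n) = plus (minus (sum_n f k) (sum_n f n)) (f (S k)).
  rewrite sum_Sn. vsolve.
exact: P_plus.
Qed.

Variable c : nat -> nat -> X.
Hypothesis Hc : forall k j, P (c k j).

(** Row [k] of the triangle is an initial segment of row [k] of the square. The predicate [P] is
    later the cone [C], or nonnegativity of reals. *)
Lemma square_minus_triangle n :
  P (minus (sum_n (fun k => sum_n (c k) n) n)
           (sum_n (fun m => sum_n (fun k => c k (m - k)%nat) m) n)).
Proof.
rewrite triangle_rows -sum_n_minus. apply: sum_n_closed => // k Hk.
apply: sum_n_mono => //. lia.
Qed.

(** For [k] at most [n], row [k] of the triangle of size [n + n] has length at least that of the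
    square, and the rows beyond [n] satisfy [P]. With the previous lemma, squares and triangles have
    the same limit. *)
Lemma triangle_minus_square n :
  P (minus (sum_n (fun m => sum_n (fun k => c k (m - k)%nat) m) (n + n))
           (sum_n (fun k => sum_n (c k) n) n)).
Proof.
rewrite triangle_rows. set r := fun k => sum_n (c k) (n + n - k).
have -> : minus (sum_n r (n + n)) (sum_n (fun k => sum_n (c k) n) n) =
  plus (minus (sum_n r (n + n)) (sum_n r n)) (sum_n (fun k => minus (r k) (sum_n (c k) n)) n).
  rewrite sum_n_minus. vsolve.
apply: P_plus.
- apply: sum_n_mono; last lia. move=> k. exact: sum_n_closed.
- apply: sum_n_closed => // k Hk. apply: sum_n_mono => //. lia.
Qed.

End TriangleSquare.

Lemma eventually_double : filterlim (fun n => n + n)%nat eventually eventually.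
Proof. move=> P [n Hn]. exists n => m Hm. apply: Hn. lia. Qed.

(** * Calculus on the half-line *)

Lemma cont0_RInt {X : CompleteNormedModule R_AbsRing} (f : R -> X) :
  cont0 f -> cont0 (fun t => RInt f 0 t).
Proof.
move=> Hf. apply/cont0_norm => t Ht eps He.
have [d [Hd Hs]] := proj1 (cont0_norm f) Hf t Ht 1 Rlt_0_1.
set b := norm (f t) + 1.
have Hb : 0 < b by have := norm_ge_0 (f t); rewrite /b; lra.
have Hfb s : 0 <= s -> Rabs (s - t) < d -> norm (f s) <= b.
  move=> H0 Hst. have -> : f s = plus (f t) (minus (f s) (f t)) by vsolve.
  apply: Rle_trans; first exact: norm_triangle.
  rewrite /b. apply: Rplus_le_compat_l. left. exact: Hs.
have Hinc r s : 0 <= r -> r <= s -> Rabs (r - t) < d -> Rabs (s - t) < d ->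
    norm (minus (RInt f 0 s) (RInt f 0 r)) <= (s - r) * b.
  move=> Hr Hrs H1 H2. rewrite -(RInt_plus_mid f 0 r s) //; try lra.
  have -> : minus (plus (RInt f 0 r) (RInt f r s)) (RInt f 0 r) = RInt f r s by vsolve.
  apply: RInt_norm_le => // x Hx. apply: Hfb; first lra.
  move/Rabs_def2: H1 => ?. move/Rabs_def2: H2 => ?. apply: Rabs_def1; lra.
exists (Rmin d (eps / b)); split; first by apply: Rmin_glb_lt => //; apply: Rdiv_lt_0_compat.
move=> s H0 Hst.
have L1 : Rabs (s - t) < d by apply: Rlt_le_trans Hst (Rmin_l _ _).
have L2 : Rabs (s - t) * b < eps.
  have -> : eps = eps / b * b by field; lra.
  apply: Rmult_lt_compat_r => //. apply: Rlt_le_trans Hst (Rmin_r _ _).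
have L0 : Rabs (t - t) < d by rewrite Rminus_eq_0 Rabs_R0.
apply: Rle_lt_trans L2.
case: (Rle_dec t s) => Hts.
- rewrite (Rabs_pos_eq (s - t)); last lra. exact: Hinc.
- rewrite norm_minus_sym Rabs_minus_sym (Rabs_pos_eq (t - s)); last lra.
  apply: Hinc => //. lra.
Qed.

(** Semigroup quotients give right derivatives only, so the mean value inequality is proved by a
    supremum: the estimate [norm (F r - F 0) <= eps * r] reaches the supremum [c] of its range by
    continuity, and goes past [c] by the right derivative at [c] unless [c = t]. *)
Lemma right_derivative_zero {X : NormedModule R_AbsRing} (F : R -> X) t :
  0 <= t -> cont0 F ->
  (forall s, 0 <= s < t -> lim0 (fun h => scal (/ h) (minus (F (s + h)) (F s))) (zero : X)) ->
  F t = F 0.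
Proof.
move=> Ht /cont0_norm Hc Hd.
suff Heps : forall eps, 0 < eps -> norm (minus (F t) (F 0)) <= eps * t.
  have E : minus (F t) (F 0) = zero.
    apply: norm_zero_eq. apply: le_epsilon => e He.
    have He' : 0 < e / (t + 1) by apply: Rdiv_lt_0_compat; lra.
    rewrite Rplus_0_l. apply: Rle_trans (Heps _ He') _.
    apply: (Rle_trans _ (e / (t + 1) * (t + 1))); last by (right; field; lra).
    apply: Rmult_le_compat_l; lra.
  have -> : F t = plus (minus (F t) (F 0)) (F 0) by vsolve.
  by rewrite E plus_zero_l.
move=> eps He.
pose E x := 0 <= x <= t /\ forall r, 0 <= r <= x -> norm (minus (F r) (F 0)) <= eps * r.
have E0 : E 0.
  split; first lra. move=> r Hr. have -> : r = 0 by lra.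
  rewrite minus_eq_zero norm_zero. lra.
have [c [Hub Hlub]] : {c | is_lub E c}.
  apply: completeness; last by exists 0.
  exists t => x [Hx _]. lra.
have Hc0 : 0 <= c by apply: Hub.
have Hct : c <= t by apply: Hlub => x [Hx _]; lra.
have Hlt r : 0 <= r -> r < c -> norm (minus (F r) (F 0)) <= eps * r.
  move=> Hr Hrc. apply: NNPP => Hn.
  have : c <= r.
    apply: Hlub => x [Hx Hx']. apply: Rnot_lt_le => Hrx. apply: Hn. apply: Hx'. lra.
  lra.
have Hcc : norm (minus (F c) (F 0)) <= eps * c.
  case: (Rle_lt_or_eq_dec _ _ Hc0) => [Hpos|<-]; last first.
    rewrite minus_eq_zero norm_zero. lra.
  apply: le_epsilon => e Hepos.
  have [d [Hdp Hs]] := Hc c Hc0 e Hepos.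
  pose r := Rmax 0 (c - d / 2).
  have Hr0 : 0 <= r by exact: Rmax_l.
  have Hrc : r < c by apply: Rmax_lub_lt; lra.
  have Hrd : c - d / 2 <= r by exact: Rmax_r.
  have -> : minus (F c) (F 0) = plus (minus (F r) (F 0)) (opp (minus (F r) (F c))) by vsolve.
  apply: Rle_trans; first exact: norm_triangle. rewrite norm_opp.
  apply: Rplus_le_compat.
  - apply: Rle_trans (Hlt r Hr0 Hrc) _. apply: Rmult_le_compat_l; lra.
  - left. apply: Hs => //. apply: Rabs_def1; lra.
case: (Rle_lt_or_eq_dec _ _ Hct) => [Hlt_ct|<-] //.
have [d [Hdp Hh]] := proj1 (lim0_norm _ _) (Hd c (conj Hc0 Hlt_ct)) eps He.
pose x := c + Rmin (d / 2) (t - c).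
have Hx1 : x <= c + d / 2 by apply: Rplus_le_compat_l; exact: Rmin_l.
have Hx2 : x <= t by have := Rmin_r (d / 2) (t - c); rewrite /x; lra.
have Hx3 : c < x by have := Rmin_glb_lt (d / 2) (t - c) 0 ltac:(lra) ltac:(lra); rewrite /x; lra.
suff : x <= c by lra.
apply: Hub. split; first lra. move=> r Hr.
case: (Rlt_le_dec r c) => Hrc; first by apply: Hlt; lra.
case: (Rle_lt_or_eq_dec _ _ Hrc) => [Hrc'|<-] //.
have {Hh} := Hh (r - c) ltac:(lra).
have -> : c + (r - c) = r by ring.
rewrite minus_zero_r => Hn.
have -> : minus (F r) (F 0) =
    plus (scal (r - c) (scal (/ (r - c)) (minus (F r) (F c)))) (minus (F c) (F 0)).
  vsolve; lra.
apply: Rle_trans; first exact: norm_triangle.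
have -> : eps * r = (r - c) * eps + eps * c by ring.
apply: Rplus_le_compat => //. apply: Rle_trans; first exact: norm_scal.
rewrite (_ : @abs R_AbsRing (r - c) = r - c); last by apply: Rabs_pos_eq; lra.
apply: Rmult_le_compat_l; first lra. by left.
Qed.

(** The deviation [E t = F t - t * F 1] is additive and vanishes at 1, so [E t] is half of [E (2 t)]
    and also half of [E (2 t - 1)]. One of these arguments lies in [[0, 1]], hence any bound for [E]
    there can be halved indefinitely. *)
Lemma additive_bounded_linear (F : R -> R) (b : R) :
  (forall t s, 0 <= t -> 0 <= s -> F (t + s) = F t + F s) ->
  (forall t, 0 <= t <= 1 -> Rabs (F t) <= b) ->
  forall t, 0 <= t <= 1 -> F t = t * F 1.
Proof.
move=> Hadd Hb. pose E t := F t - t * F 1.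
have HE n : forall t, 0 <= t <= 1 -> Rabs (E t) <= 2 * b * (/ 2) ^ n.
  elim: n => [|n IH] t Ht.
  - rewrite /= Rmult_1_r. have H1 := Hb t Ht. have H2 := Hb 1 ltac:(lra).
    apply: Rle_trans; first exact: Rabs_triang. rewrite Rabs_Ropp Rabs_mult.
    rewrite (Rabs_pos_eq t); last lra. have := Rabs_pos (F 1). nra.
  - have [s [Hs Es]] : exists s, 0 <= s <= 1 /\ E t = / 2 * E s.
      case: (Rle_dec t (/ 2)) => Ht2.
      + exists (t + t). split; first lra. rewrite /E Hadd; lra.
      + exists (t + t - 1). split; first lra.
        have := Hadd t t ltac:(lra) ltac:(lra).
        have := Hadd (t + t - 1) 1 ltac:(lra) ltac:(lra).
        have -> : t + t - 1 + 1 = t + t by ring.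
        rewrite /E. lra.
    rewrite Es Rabs_mult (Rabs_pos_eq (/ 2)); last lra.
    rewrite /=. have := IH s Hs. lra.
move=> t Ht. have HE0 : Rabs (E t) <= 0.
  have Hlim : is_lim_seq (fun n => 2 * b * (/ 2) ^ n) 0.
    have := is_lim_seq_scal_l _ (2 * b) _ (is_lim_seq_geom (/ 2) ltac:(rewrite Rabs_pos_eq; lra)).
    by rewrite /= Rmult_0_r.
  exact: (is_lim_seq_le _ _ (Rabs (E t)) 0 (fun n => HE n t Ht) (is_lim_seq_const _) Hlim).
have := Rabs_pos (E t). move=> H0.
have : E t = 0 by apply: NNPP => Hn; have := Rabs_pos_lt _ Hn; lra.
rewrite /E. lra.
Qed.

Lemma lim_seq_le (f g : nat -> R) (a b : R) :
  (forall n, f n <= g n) -> filterlim f eventually (locally a) ->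
  filterlim g eventually (locally b) -> a <= b.
Proof. move=> H Hf Hg. exact: (is_lim_seq_le f g (Finite a) (Finite b) H Hf Hg). Qed.

(** * Abstract state spaces *)

Section Cone.
Context {X : CompleteNormedModule R_AbsRing} (C : X -> Prop) (Psi : X -> R) (M : R).
Hypothesis HX : abstract_state_space C.
Hypothesis HPsi : norm_functional C Psi.
Hypothesis HM : decomposition_constant C M.

Lemma Psi_plus u v : Psi (plus u v) = Psi u + Psi v.
Proof. exact: (linear_plus Psi (proj1 HPsi)). Qed.

Lemma Psi_scal c u : Psi (scal c u) = c * Psi u.
Proof. exact: (linear_scal Psi (proj1 HPsi)). Qed.

Lemma Psi_opp u : Psi (opp u) = - Psi u.
Proof. exact: (lin_opp (Y := R_NormedModule) Psi u (proj1 HPsi)). Qed.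

Lemma Psi_minus u v : Psi (minus u v) = Psi u - Psi v.
Proof. exact: (lin_minus (Y := R_NormedModule) Psi u v (proj1 HPsi)). Qed.

Lemma Psi_cone u : C u -> Psi u = norm u.
Proof. exact: (proj2 HPsi). Qed.

Lemma Psi_ge_0 u : C u -> 0 <= Psi u.
Proof. move=> Hu. rewrite Psi_cone //. exact: norm_ge_0. Qed.

Lemma cone_sum f n : (forall k, (k <= n)%nat -> C (f k)) -> C (sum_n f n).
Proof. apply: sum_n_closed. exact: (cone_plus HX). Qed.

Lemma cone_RInt (f : R -> X) a b l :
  a <= b -> (forall s, a <= s <= b -> C (f s)) -> is_RInt f a b l -> C l.
Proof.
apply: is_RInt_cone; [exact: (cone_closed HX)|exact: (cone_zero HX)|
  exact: (cone_plus HX)|exact: (cone_scal HX)].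
Qed.

Lemma cone_lim {I : Type} (F : (I -> Prop) -> Prop) {FF : ProperFilter F} f l :
  F (fun i => C (f i)) -> filterlim f F (locally l) -> C l.
Proof.
move=> HC Hl. apply: (closed_filterlim_loc (F := F) (FF := Proper_StrongProper _ FF) f C l) => //.
exact: (cone_closed HX).
Qed.

(** The factor 2 counts the two parts of the decomposition, each of norm at most [M * norm u]. *)
Lemma cone_bound_extends (L : X -> X) :
  is_linear L -> (forall u, C u -> norm (L u) <= norm u) ->
  forall u, norm (L u) <= 2 * M * norm u.
Proof.
move=> HL H u. have [u1 [u2 [H1 [H2 [-> [H3 H4]]]]]] := proj2 HM u.
rewrite (lin_minus L) //. apply: Rle_trans; first exact: norm_minus_le.
have := H _ H1. have := H _ H2. lra.
Qed.

Lemma substochastic_bound T : substochastic C T ->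
  forall t u, 0 <= t -> norm (T t u) <= 2 * M * norm u.
Proof.
move=> [HT HC] t u Ht. apply: cone_bound_extends; first exact: (semigroup_bounded HT).
move=> v Hv. by case: (HC t v Ht Hv).
Qed.

Lemma M_ge_0 : 0 <= 2 * M.
Proof. case: HM => H _. lra. Qed.

Lemma substochastic_family T : substochastic C T -> bounded_family (2 * M) T.
Proof.
move=> HT. apply: semigroup_family; [exact: M_ge_0|exact: (proj1 HT)|].
exact: substochastic_bound.
Qed.

Lemma cone_antisym u v : C (minus u v) -> C (minus v u) -> u = v.
Proof.
move=> H1 H2. have E : minus u v = zero.
  apply: (cone_pointed HX) => //. by rewrite opp_minus.
have -> : u = plus (minus u v) v by vsolve. by rewrite E plus_zero_l.
Qed.

(** On the cone the norm is the linear functional [Psi], so the distance between two terms of an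
    increasing sequence is the difference of their [Psi] values. Convergence of that real sequence
    makes the vectors Cauchy. *)
Lemma cone_monotone_cv (x : nat -> X) K :
  (forall n, C (minus (x (S n)) (x n))) -> (forall n, Psi (x n) <= K) ->
  exists w, filterlim x eventually (locally w).
Proof.
move=> Hx HK.
have Hle n m : (n <= m)%nat -> C (minus (x m) (x n)).
  elim=> [|k _ IH]; first by rewrite minus_eq_zero; exact: (cone_zero HX).
  have -> : minus (x (S k)) (x n) = plus (minus (x k) (x n)) (minus (x (S k)) (x k)) by vsolve.
  exact: (cone_plus HX).
have Hd n m : (n <= m)%nat -> norm (minus (x m) (x n)) = Psi (x m) - Psi (x n).
  move=> H. by rewrite -Psi_cone ?Psi_minus //; apply: Hle.
have [l Hl] : ex_finite_lim_seq (fun n => Psi (x n)).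
  apply: (ex_finite_lim_seq_incr _ K) => // n.
  have := norm_ge_0 (minus (x (S n)) (x n)). rewrite Hd; last lia. lra.
have HC := proj1 (ex_lim_seq_cauchy_corr _) (ex_intro _ l Hl).
apply/(filterlim_locally_cauchy (F := eventually)) => eps.
have [N HN] := HC eps. exists (fun n => (N <= n)%nat); split; first by exists N.
move=> n m Hn Hm. apply: norm_compat1.
case: (Nat.le_ge_cases n m) => Hnm.
- rewrite Hd //. apply: Rle_lt_trans (Rle_abs _) _. exact: HN.
- rewrite norm_minus_sym Hd //. apply: Rle_lt_trans (Rle_abs _) _. exact: HN.
Qed.

End Cone.

(** * The Dyson-Phillips iterates *)

Section Perturbation.
Context {X : CompleteNormedModule R_AbsRing} (C : X -> Prop) (Psi : X -> R) (M : R).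
Variables (U : R -> X -> X) (A : operator X) (B : X -> X) (Vn : nat -> R -> X -> X).
Hypothesis HX : abstract_state_space C.
Hypothesis HPsi : norm_functional C Psi.
Hypothesis HM : decomposition_constant C M.
Hypothesis HU : substochastic C U.
Hypothesis HA : is_generator U A.
Hypothesis HBlin : linear_on (dom A) B.
Hypothesis HBpos : positive_on C (dom A) B.
Hypothesis HAB : forall u, dom A u -> C u -> Psi (plus (A u) (B u)) <= 0.
Hypothesis HVn : dyson_phillips C U A B Vn.

Let HU0 := proj1 HU.
Let HUK := substochastic_bound C M HM U HU.
Let HUF := substochastic_family C M HM U HU.
Let HK := M_ge_0 C M HM.

Lemma U_cone t u : 0 <= t -> C u -> C (U t u).
Proof. move=> Ht Hu. by case: (proj2 HU t u Ht Hu). Qed.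

Lemma B_minus u v : dom A u -> dom A v -> B (minus u v) = minus (B u) (B v).
Proof.
move=> Hu Hv. have [H _] := generator_scal U A HU0 HA (-1) v Hv.
have -> : minus u v = plus u (scal (-1) v) by vsolve.
rewrite (proj1 HBlin) // (proj2 HBlin) //. vsolve.
Qed.

(* Replaces the [A]-boundedness of [B], so that the resolvent of [A] is never needed. *)
Lemma B_norm u : dom A u -> C u -> norm (B u) <= - Psi (A u).
Proof.
move=> Hd Hu. have := HAB u Hd Hu. rewrite (Psi_plus C) //.
rewrite (Psi_cone C Psi HPsi (B u)); last exact: HBpos. lra.
Qed.

Lemma orbit_int_U_dom t y : 0 <= t ->
  dom A (orbit_int U t y) /\ A (orbit_int U t y) = minus (U t y) y.
Proof. move=> Ht. by apply: (generator_orbit_int (2 * M)). Qed.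

Lemma orbit_int_U_cone t y : 0 <= t -> C y -> C (orbit_int U t y).
Proof.
move=> Ht Hy. apply: (cone_RInt C HX (fun s => U s y) 0 t) => //.
- move=> s Hs. apply: U_cone => //. lra.
- exact: (orbit_RInt _ _ HUF).
Qed.

(** [A] sends the orbit integral to [U h y - y], so [B_norm] becomes an estimate by the mass that
    [U] loses. *)
Lemma B_orbit_int h y : 0 <= h -> C y ->
  norm (B (orbit_int U h y)) <= Psi y - Psi (U h y).
Proof.
move=> Hh Hy. have [Hd E] := orbit_int_U_dom h y Hh.
have := B_norm _ Hd (orbit_int_U_cone h y Hh Hy).
rewrite E (Psi_minus C) //. lra.
Qed.

Lemma U_increment t h u : 0 <= t -> 0 <= h -> dom A u ->
  minus (U (t + h) u) (U t u) = orbit_int U h (U t (A u)).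
Proof.
move=> Ht Hh Hu. have [Hd <-] := generator_comm U A HU0 HA t u Ht Hu.
rewrite (orbit_int_generator (2 * M) U A HK HU0 HUK HA h _ Hh Hd).
by rewrite Rplus_comm (semigroup_plus HU0).
Qed.

(* With [A u = y1 - y2], the increment of [U s u] is a difference of orbit integrals of
   positive vectors, which lie in the domain of [A] and to which [B_norm] applies. *)
Lemma BU_cont0 u : dom A u -> cont0 (fun s => B (U s u)).
Proof.
move=> Hu. have [y1 [y2 [H1 [H2 E]]]] := cone_generating HX (A u).
apply: (cont0_dominated _ (fun s => Psi (plus (U s y1) (U s y2)))).
- apply: (cont0_lin (Y := R_NormedModule)); first exact: (proj1 HPsi).
  apply: cont0_plus; exact: (family_cont _ _ HUF).
- move=> t s Hts. set h := s - t. have -> : s = t + h by rewrite /h; ring.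
  have Hh : 0 <= h by rewrite /h; lra.
  have Ht : 0 <= t by lra.
  have D1 := proj1 (generator_comm U A HU0 HA t u Ht Hu).
  have D2 := proj1 (generator_comm U A HU0 HA (t + h) u (Rplus_le_le_0_compat _ _ Ht Hh) Hu).
  rewrite -B_minus // U_increment // E (lin_minus (U t)); last exact: (semigroup_bounded HU0).
  rewrite (lin_minus (orbit_int U h)); last exact: (orbit_int_lin (2 * M)).
  rewrite B_minus; try exact: (proj1 (orbit_int_U_dom _ _ _)).
  apply: Rle_trans; first exact: norm_minus_le.
  have := B_orbit_int h _ Hh (U_cone t y1 Ht H1).
  have := B_orbit_int h _ Hh (U_cone t y2 Ht H2).
  rewrite -!(semigroup_plus HU0) // !(Psi_plus C) // (Rplus_comm h t) => G1 G2.
  rewrite Rabs_minus_sym. apply: Rle_trans (Rle_abs _). lra.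
Qed.

Lemma Vn_0 t u : 0 <= t -> Vn 0 t u = U t u.
Proof. exact: (proj1 HVn). Qed.

Lemma Vn_lin n t : 0 <= t -> is_linear (Vn n t).
Proof.
case: n => [|n] Ht; last by case: (proj2 HVn n t Ht).
have [H1 H2 [K [H3 H4]]] := semigroup_bounded HU0 Ht.
split; [move=> u v|move=> c u|exists K; split=> // u]; rewrite !Vn_0 //.
Qed.

Lemma Vn_cone n t u : 0 <= t -> C u -> C (Vn n t u).
Proof.
case: n => [|n] Ht Hu; first by rewrite Vn_0 //; apply: U_cone.
have [_ [H _]] := proj2 HVn n t Ht. exact: H.
Qed.

Lemma Vn_Duhamel n t u : 0 <= t -> dom A u ->
  is_RInt (fun s => Vn n (t - s) (B (U s u))) 0 t (Vn (S n) t u).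
Proof. move=> Ht. have [_ [_ H]] := proj2 HVn n t Ht. exact: H. Qed.

(** * Partial sums of the series and their mass *)

Definition Wn (n : nat) (t : R) (u : X) : X := sum_n (fun k => Vn k t u) n.

Lemma Wn_S n t u : Wn (S n) t u = plus (Wn n t u) (Vn (S n) t u).
Proof. by rewrite /Wn sum_Sn. Qed.

Lemma Wn_0 t u : 0 <= t -> Wn 0 t u = U t u.
Proof. move=> Ht. by rewrite /Wn sum_O Vn_0. Qed.

Lemma Wn_lin n t : 0 <= t -> is_linear (Wn n t).
Proof. move=> Ht. apply: is_linear_sum => k. exact: Vn_lin. Qed.

Lemma Wn_cone n t u : 0 <= t -> C u -> C (Wn n t u).
Proof. move=> Ht Hu. apply: (cone_sum C) => // k _. exact: Vn_cone. Qed.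

Lemma Wn_Duhamel n t u : 0 <= t -> dom A u ->
  is_RInt (fun s => Wn n (t - s) (B (U s u))) 0 t (minus (Wn (S n) t u) (U t u)).
Proof.
move=> Ht Hu.
have -> : minus (Wn (S n) t u) (U t u) = sum_n (fun k => Vn (S k) t u) n.
  rewrite /Wn sum_n_shift Vn_0 //. vsolve.
elim: n => [|n IH].
- rewrite sum_O. apply: is_RInt_ext (Vn_Duhamel 0 t u Ht Hu) => s _.
  by rewrite /Wn sum_O.
- rewrite sum_Sn.
  apply: is_RInt_ext (is_RInt_plus _ _ _ _ _ _ IH (Vn_Duhamel (S n) t u Ht Hu)) => s _.
  by rewrite Wn_S.
Qed.

(** In Duhamel's formula the integrand has, by induction, mass at most that of [B (U s v)], hence at
    most [- Psi (A (U s v))]. The integral of the latter is exactly the mass [Psi v - Psi (U t v)]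
    lost by [U]. *)
Lemma Wn_Psi n t u : 0 <= t -> C u -> Psi (Wn n t u) <= Psi u.
Proof.
elim: n t u => [|n IH] t u Ht Hu.
  rewrite Wn_0 // !(Psi_cone C) //; last exact: U_cone.
  by case: (proj2 HU t u Ht Hu).
have Hdom : forall v, dom A v -> C v -> Psi (Wn (S n) t v) <= Psi v.
  move=> v Hd Hv.
  have I1 := is_RInt_lin (Y := R_NormedModule) Psi _ _ _ _ (proj1 HPsi) (Wn_Duhamel n t v Ht Hd).
  have I2 := is_RInt_opp _ _ _ _ (is_RInt_lin (Y := R_NormedModule) Psi _ _ _ _ (proj1 HPsi)
    (orbit_RInt _ _ HUF t (A v) Ht)).
  rewrite (orbit_int_generator (2 * M) U A HK HU0 HUK HA) // in I2.
  have := is_RInt_le _ _ _ _ _ _ Ht I1 I2.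
  rewrite /opp /= !(Psi_minus C) // => H.
  suff : Psi (Wn (S n) t v) - Psi (U t v) <= - (Psi (U t v) - Psi v) by lra.
  apply: H => s Hs.
  have Hs0 : 0 <= s by lra.
  have [D E] := generator_comm U A HU0 HA s v Hs0 Hd.
  have HUv := U_cone s v Hs0 Hv.
  rewrite -E. apply: Rle_trans; first (apply: IH; [lra|exact: HBpos]).
  rewrite (Psi_cone C) //; [exact: B_norm|exact: HBpos].
(* From the domain of [A] to the whole cone: the means of the orbit of [u] are positive and lie in
   the domain. *)
have Ha := generator_approx (2 * M) U HK HU0 HUK u.
have HW := Wn_lin (S n) t Ht.
apply: lim0_le (fl_lin (Y := R_NormedModule) _ Psi _ _ (proj1 HPsi) (fl_lin _ _ _ _ HW Ha))
  (fl_lin (Y := R_NormedModule) _ Psi _ _ (proj1 HPsi) Ha).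
apply: at_right_pos => h Hh. apply: Hdom.
- exact: (generator_approx_dom (2 * M)).
- apply: (cone_scal HX); first by left; apply: Rinv_0_lt_compat.
  apply: orbit_int_U_cone => //. lra.
Qed.

Lemma Wn_minus_U_cone n t u : 0 <= t -> C u -> C (minus (Wn n t u) (U t u)).
Proof.
move=> Ht Hu. case: n => [|n].
- rewrite Wn_0 // minus_eq_zero. exact: (cone_zero HX).
- have -> : minus (Wn (S n) t u) (U t u) = sum_n (fun k => Vn (S k) t u) n.
    rewrite /Wn sum_n_shift Vn_0 //. vsolve.
  apply: (cone_sum C) => // k _. exact: Vn_cone.
Qed.

(* The mass available to all the later iterates is what [U] has lost. *)
Lemma Wn_minus_U_norm n t u : 0 <= t -> C u ->
  norm (minus (Wn n t u) (U t u)) <= Psi u - Psi (U t u).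
Proof.
move=> Ht Hu. rewrite -(Psi_cone C Psi HPsi); last exact: Wn_minus_U_cone.
rewrite (Psi_minus C) //. have := Wn_Psi n t u Ht Hu. lra.
Qed.

Lemma Vn_S_norm n t u : 0 <= t -> C u ->
  norm (Vn (S n) t u) <= Psi u - Psi (U t u).
Proof.
move=> Ht Hu. rewrite -(Psi_cone C Psi HPsi); last exact: Vn_cone.
have := Wn_Psi (S n) t u Ht Hu. rewrite Wn_S (Psi_plus C) //.
have := Psi_ge_0 C Psi HPsi _ (Wn_minus_U_cone n t u Ht Hu).
rewrite (Psi_minus C) //. lra.
Qed.

Lemma Wn_norm n t u : 0 <= t -> C u -> norm (Wn n t u) <= norm u.
Proof.
move=> Ht Hu. rewrite -!(Psi_cone C Psi HPsi) //; last exact: Wn_cone.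
exact: Wn_Psi.
Qed.

Lemma Wn_bound n t u : 0 <= t -> norm (Wn n t u) <= 2 * M * norm u.
Proof.
move=> Ht. apply: (cone_bound_extends C M HM); first exact: Wn_lin.
move=> v. exact: Wn_norm.
Qed.

Lemma Vn_bound n t u : 0 <= t -> norm (Vn n t u) <= 2 * M * norm u.
Proof.
move=> Ht. apply: (cone_bound_extends C M HM); first exact: Vn_lin.
move=> v Hv. case: n => [|n]; first by (have := Wn_norm 0 t v Ht Hv; rewrite Wn_0 // Vn_0).
apply: Rle_trans; first exact: Vn_S_norm.
rewrite -(Psi_cone C Psi HPsi v) //.
have := Psi_ge_0 C Psi HPsi _ (U_cone t v Ht Hv). lra.
Qed.

(** With [u = y1 - y2], the modulus [q] adds the mass losses of [y1] and [y2] to the increment of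
    [U]. Its independence of [n] is what later allows the limits in [n] and in [h] to be
    exchanged. *)
Lemma short_time u : exists q : R -> R,
  (forall n h, 0 <= h -> norm (minus (Wn n h u) u) <= q h) /\
  (forall n h, 0 <= h -> norm (Vn (S n) h u) <= q h) /\
  (forall eps, 0 < eps -> exists d, 0 < d /\ forall h, 0 <= h < d -> q h < eps).
Proof.
have [y1 [y2 [H1 [H2 E]]]] := cone_generating HX u.
pose loss y h := Psi y - Psi (U h y).
have Hloss y h : 0 <= h -> C y -> 0 <= loss y h.
  move=> Hh Hy. have := Wn_Psi 0 h y Hh Hy. rewrite Wn_0 // /loss. lra.
exists (fun h => loss y1 h + loss y2 h + norm (minus (U h u) u)). split; [|split].
- move=> n h Hh.
  have -> : minus (Wn n h u) u = plus (minus (minus (Wn n h y1) (U h y1))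
      (minus (Wn n h y2) (U h y2))) (minus (U h u) u).
    rewrite {1 3}E (lin_minus (Wn n h)); last exact: Wn_lin.
    rewrite (lin_minus (U h)); last exact: (semigroup_bounded HU0). vsolve.
  apply: Rle_trans; first exact: norm_triangle. apply: Rplus_le_compat_r.
  apply: Rle_trans; first exact: norm_minus_le.
  apply: Rplus_le_compat; exact: Wn_minus_U_norm.
- move=> n h Hh. rewrite {1}E (lin_minus (Vn (S n) h)); last exact: Vn_lin.
  apply: Rle_trans; first exact: norm_minus_le.
  have := Vn_S_norm n h y1 Hh H1. have := Vn_S_norm n h y2 Hh H2.
  have := norm_ge_0 (minus (U h u) u). rewrite /loss /=. lra.
- move=> eps He.
  have Hc y := proj1 (cont0_norm _) (family_cont _ _ HUF y) 0 (Rle_refl 0).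
  have HP y : cont0 (X := R_NormedModule) (fun h => Psi (U h y)).
    apply: cont0_lin; [exact: (proj1 HPsi)|exact: (family_cont _ _ HUF)].
  have He3 : 0 < eps / 3 by lra.
  have [d1 [Hd1 G1]] := proj1 (cont0_norm _) (HP y1) 0 (Rle_refl 0) _ He3.
  have [d2 [Hd2 G2]] := proj1 (cont0_norm _) (HP y2) 0 (Rle_refl 0) _ He3.
  have [d3 [Hd3 G3]] := Hc u _ He3.
  exists (Rmin d1 (Rmin d2 d3)). split.
    by repeat apply: Rmin_glb_lt.
  move=> h [Hh Hlt].
  have L1 : h < d1 by apply: Rlt_le_trans Hlt (Rmin_l _ _).
  have L2 : h < d2.
    apply: Rlt_le_trans Hlt _. apply: Rle_trans (Rmin_r _ _) (Rmin_l _ _).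
  have L3 : h < d3.
    apply: Rlt_le_trans Hlt _. apply: Rle_trans (Rmin_r _ _) (Rmin_r _ _).
  have Ha : Rabs (h - 0) = h by rewrite Rminus_0_r Rabs_pos_eq.
  have K1 := G1 h Hh ltac:(by rewrite Ha). have K2 := G2 h Hh ltac:(by rewrite Ha).
  have K3 := G3 h Hh ltac:(by rewrite Ha).
  rewrite !(semigroup_zero HU0) in K1 K2 K3.
  have {}K1 : Rabs (Psi (U h y1) - Psi y1) < eps / 3 by exact: K1.
  have {}K2 : Rabs (Psi (U h y2) - Psi y2) < eps / 3 by exact: K2.
  move/Rabs_def2: K1 => [_ K1]. move/Rabs_def2: K2 => [_ K2].
  rewrite /loss.
  have -> : eps = eps / 3 + eps / 3 + eps / 3 by field.
  apply: Rplus_lt_compat; last exact: K3. apply: Rplus_lt_compat; lra.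
Qed.

Lemma Vn_S_0 n u : Vn (S n) 0 u = zero.
Proof.
have [q [_ [H1 H2]]] := short_time u. apply: norm_zero_eq.
apply: le_epsilon => eps He. have [d [Hd Hq]] := H2 eps He.
rewrite Rplus_0_l. apply: Rle_trans (H1 n 0 (Rle_refl 0)) _. left. apply: Hq. lra.
Qed.

(** The semigroup law sorted by degree in [B]. Duhamel's integral over [[0, t + s]] is cut at [s]:
    on the left piece the induction hypothesis extracts the factors [Vn k t], and the right piece,
    shifted by [s], is the remaining term [Vn (S n) t (U s u)]. *)
Lemma Vn_plus n t s u : 0 <= t -> 0 <= s ->
  Vn n (t + s) u = sum_n (fun k => Vn k t (Vn (n - k) s u)) n.
Proof.
elim: n t s u => [|n IH] t s u Ht Hs.
  rewrite sum_O !Vn_0 ?(semigroup_plus HU0) //; lra.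
have Hts : 0 <= t + s by lra.
apply: (generator_dense_eq (2 * M) U A HK HU0 HUK HA (Vn (S n) (t + s))
  (fun u => sum_n (fun k => Vn k t (Vn (S n - k) s u)) (S n))).
- exact: Vn_lin.
- apply: (is_linear_sum (fun k u => Vn k t (Vn (S n - k) s u))) => k.
  apply: is_linear_comp; exact: Vn_lin.
move=> {}u Hu.
pose F r := Vn n (t + s - r) (B (U r u)).
have I0 : is_RInt F 0 (t + s) (Vn (S n) (t + s) u) := Vn_Duhamel n (t + s) u Hts Hu.
have I1 : is_RInt F 0 s (sum_n (fun k => Vn k t (Vn (S (n - k)) s u)) n).
  apply: (is_RInt_ext (fun r => sum_n (fun k => Vn k t (Vn (n - k) (s - r) (B (U r u)))) n)).
    rewrite Rmin_left // Rmax_right // => r Hr. rewrite /F -IH //; last lra.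
    by congr (Vn n _ _); ring.
  apply: (is_RInt_sum_n (fun k r => Vn k t (Vn (n - k) (s - r) (B (U r u))))) => k.
  apply: (is_RInt_lin (Vn k t)); first exact: Vn_lin.
  exact (Vn_Duhamel (n - k) s u Hs Hu).
have I2 : is_RInt F s (t + s) (Vn (S n) t (U s u)).
  have Hd := proj1 (generator_comm U A HU0 HA s u Hs Hu).
  apply: (is_RInt_ext (fun r => Vn n (t - (r + - s)) (B (U (r + - s) (U s u))))).
    rewrite Rmin_left ?Rmax_right; try lra. move=> r Hr.
    rewrite /F -(semigroup_plus HU0); try lra.
    have -> : t - (r + - s) = t + s - r by ring.
    by have -> : r + - s + s = r by ring.
  apply: (is_RInt_shift (fun r => Vn n (t - r) (B (U r (U s u))))).
  have -> : s + - s = 0 by ring. have -> : t + s + - s = t by ring.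
  exact (Vn_Duhamel n t _ Ht Hd).
have E := is_RInt_unique _ _ _ _ (is_RInt_Chasles _ _ _ _ _ _ I1 I2).
rewrite (is_RInt_unique _ _ _ _ I0) in E. rewrite E sum_Sn Nat.sub_diag Vn_0 //.
congr plus. apply: sum_n_ext_loc => k Hk. by rewrite Nat.sub_succ_l.
Qed.

(** By [Vn_plus], the increment over [h] is [Vn n t (U h u - u)] plus [n] terms
    [Vn k t (Vn (n - k) h u)]. Each of these [n + 1] vectors has norm at most [2 * M * q h],
    uniformly in [t]. *)
Lemma Vn_cont0 n u : cont0 (fun t => Vn n t u).
Proof.
have [q [Hq1 [Hq2 Hq]]] := short_time u.
have Hinc t h : 0 <= t -> 0 <= h ->
    norm (minus (Vn n (t + h) u) (Vn n t u)) <= (INR n + 1) * (2 * M * q h).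
  move=> Ht Hh. rewrite Vn_plus //.
  have Hn k x : norm x <= q h -> norm (Vn k t x) <= 2 * M * q h.
    move=> Hx. apply: Rle_trans (Vn_bound k t x Ht) _.
    exact: (Rmult_le_compat_l _ _ _ HK Hx).
  have Hlast : norm (minus (Vn n t (Vn 0 h u)) (Vn n t u)) <= 2 * M * q h.
    rewrite -(lin_minus (Vn n t)); last exact: Vn_lin. apply: Hn.
    have := Hq1 0%nat h Hh. by rewrite Wn_0 // Vn_0.
  case: (n) Hlast => [|m] Hlast.
  - rewrite sum_O /=. apply: Rle_trans Hlast _. right. ring.
  - rewrite sum_Sn Nat.sub_diag /minus -plus_assoc.
    apply: Rle_trans; first exact: norm_triangle.
    rewrite Rmult_plus_distr_r Rmult_1_l.
    apply: Rplus_le_compat; last exact: Hlast.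
    rewrite S_INR. apply: norm_sum_n_le => k Hk. apply: Hn.
    rewrite Nat.sub_succ_l //. exact: Hq2.
apply: cont0_modulus => eps He.
have Hpos : 0 < (INR n + 1) * (2 * M + 1) by have := pos_INR n; have := HK; nra.
have [d [Hd Hh]] := Hq (eps / ((INR n + 1) * (2 * M + 1))) ltac:(exact: Rdiv_lt_0_compat).
exists d; split=> // t h Ht Hhd.
have Hh0 : 0 <= h by lra.
apply: Rle_lt_trans (Hinc t h Ht Hh0) _.
have Hq0 : 0 <= q h by apply: Rle_trans (norm_ge_0 _) (Hq2 0%nat h Hh0).
have {Hh} := Hh h ltac:(lra) => Hlt.
apply: (Rle_lt_trans _ ((INR n + 1) * (2 * M + 1) * q h)).
  rewrite (Rmult_assoc (INR n + 1)). apply: Rmult_le_compat_l; first by have := pos_INR n; lra.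
  lra.
have := Rmult_lt_compat_l _ _ _ Hpos Hlt.
have -> : (INR n + 1) * (2 * M + 1) * (eps / ((INR n + 1) * (2 * M + 1))) = eps.
  by field; have := pos_INR n; have := HK; lra.
by [].
Qed.

Lemma Vn_family n : bounded_family (2 * M) (Vn n).
Proof.
split; [move=> t; exact: Vn_lin|move=> t u; exact: Vn_bound|exact: Vn_cont0].
Qed.

(** The quotient is the mean over [[0, h]] of Duhamel's integrand, which is close to [B u] by
    continuity of [B (U s u)] and by [short_time] at [B u]. The same [d] serves all [n], so the
    estimate survives the limit in [n]. *)
Lemma Wn_derivative u : dom A u -> forall eps, 0 < eps -> exists d, 0 < d /\
  forall n h, 0 < h < d ->
    norm (minus (scal (/ h) (minus (Wn (S n) h u) (U h u))) (B u)) <= eps.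
Proof.
move=> Hu eps He.
have [q [Hq1 [_ Hq]]] := short_time (B u).
have He' : 0 < eps / 2 / (2 * M + 1) by apply: Rdiv_lt_0_compat; have := HK; lra.
have [d1 [Hd1 G1]] := proj1 (cont0_norm _) (BU_cont0 u Hu) 0 (Rle_refl 0) _ He'.
have [d2 [Hd2 G2]] := Hq (eps / 2) ltac:(lra).
exists (Rmin d1 d2); split; first exact: Rmin_glb_lt.
move=> n h [Hh Hlt].
have L1 : h < d1 by apply: Rlt_le_trans Hlt (Rmin_l _ _).
have L2 : h < d2 by apply: Rlt_le_trans Hlt (Rmin_r _ _).
apply: (is_RInt_mean (fun s => Wn n (h - s) (B (U s u)))) => //; last first.
  apply: Wn_Duhamel => //; lra.
move=> s Hs. have Hs0 : 0 <= s by lra. have Hhs : 0 <= h - s by lra.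
have -> : minus (Wn n (h - s) (B (U s u))) (B u) =
  plus (Wn n (h - s) (minus (B (U s u)) (B u))) (minus (Wn n (h - s) (B u)) (B u)).
  rewrite (lin_minus (Wn n (h - s))); last exact: Wn_lin. vsolve.
apply: Rle_trans; first exact: norm_triangle.
have -> : eps = eps / 2 + eps / 2 by field.
apply: Rplus_le_compat.
- apply: Rle_trans (Wn_bound _ _ _ Hhs) _.
  have {G1} := G1 s Hs0 ltac:(rewrite Rminus_0_r Rabs_pos_eq; lra).
  rewrite (semigroup_zero HU0).
  have := norm_ge_0 (minus (B (U s u)) (B u)). rewrite /=.
  set x := norm _ => Hx Hlt'.
  have : (2 * M + 1) * x < (2 * M + 1) * (eps / 2 / (2 * M + 1)).
    apply: Rmult_lt_compat_l => //. have := HK; lra.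
  have -> : (2 * M + 1) * (eps / 2 / (2 * M + 1)) = eps / 2 by field; have := HK; lra.
  lra.
- apply: Rle_trans (Hq1 n _ Hhs) _. left. apply: G2. lra.
Qed.

(** [Vn 1] carries the whole derivative [B u]: all [Wn (S n) - U] have the same one, so the higher
    iterates, being differences of consecutive partial sums, have derivative zero. *)
Lemma Vn_derivative j u : dom A u ->
  lim0 (fun h => scal (/ h) (Vn (S j) h u)) (match j with 0%nat => B u | S _ => zero end).
Proof.
move=> Hu.
have HW n : lim0 (fun h => scal (/ h) (minus (Wn (S n) h u) (U h u))) (B u).
  apply/lim0_norm => eps He.
  have [d [Hd H]] := Wn_derivative u Hu (eps / 2) ltac:(lra).
  exists d; split=> // h Hh. apply: Rle_lt_trans (H n h Hh) _. lra.
case: j => [|j].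
- apply: lim0_ext (HW 0%nat) => h Hh. rewrite Wn_S Wn_0; last lra. vsolve; lra.
- have -> : zero = minus (B u) (B u) by rewrite minus_eq_zero.
  apply: lim0_ext (fl_minus _ _ _ _ _ (HW (S j)) (HW j)) => h Hh.
  rewrite (Wn_S (S j)). vsolve; lra.
Qed.

Lemma U_orbit_int_Vn n t h v : 0 <= t -> 0 <= h ->
  RInt (fun s => Vn (S n) s v) h (t + h) =
  plus (U h (orbit_int (Vn (S n)) t v))
    (sum_n (fun j => Vn (S j) h (orbit_int (Vn (n - j)) t v)) n).
Proof.
move=> Ht Hh. have Hc := Vn_cont0 (S n) v.
have I1 : is_RInt (fun s => Vn (S n) (s + h) v) 0 t (RInt (fun s => Vn (S n) s v) h (t + h)).
  apply: (is_RInt_shift (fun s => Vn (S n) s v)). rewrite Rplus_0_l.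
  apply: is_RInt_RInt => //. lra.
rewrite -(is_RInt_unique _ _ _ _ I1). apply: is_RInt_unique.
apply: (is_RInt_ext (fun s => plus (U h (Vn (S n) s v))
    (sum_n (fun j => Vn (S j) h (Vn (n - j) s v)) n))).
  rewrite Rmin_left // => s [Hs _].
  rewrite Rplus_comm Vn_plus //; last lra. by rewrite sum_n_shift Vn_0 // Nat.sub_0_r.
apply: is_RInt_plus.
- apply: (is_RInt_lin (U h)); first exact: (semigroup_bounded HU0).
  exact (orbit_RInt _ _ (Vn_family (S n)) t v Ht).
- apply: (is_RInt_sum_n (fun j s => Vn (S j) h (Vn (n - j) s v))) => j.
  apply: (is_RInt_lin (Vn (S j) h)); first exact: Vn_lin.
  exact (orbit_RInt _ _ (Vn_family (n - j)) t v Ht).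
Qed.

(* Uses the difference quotient of [U] at [int_0^t V_(n+1) v]: by the Cauchy product,
   [U h V_(n+1)(s)] is [V_(n+1)(s + h)] up to the terms [V_(j+1)(h) V_(n-j)(s)]. *)
Lemma orbit_int_Vn_step n t v : 0 <= t ->
  (forall k, (k <= n)%nat -> dom A (orbit_int (Vn k) t v)) ->
  dom A (orbit_int (Vn (S n)) t v) /\
  A (orbit_int (Vn (S n)) t v) = minus (Vn (S n) t v) (B (orbit_int (Vn n) t v)).
Proof.
move=> Ht Hd. apply: (generator_intro U A HA).
have Hc := Vn_cont0 (S n) v.
have L1 := ftc_right _ _ Hc Ht. have L0 := orbit_mean _ _ (Vn_family (S n)) v.
rewrite Vn_S_0 in L0.
have L2 := fl_sum (at_right 0)
  (fun j h => scal (/ h) (Vn (S j) h (orbit_int (Vn (n - j)) t v)))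
  (fun j => match j with 0%nat => B (orbit_int (Vn (n - j)) t v) | S _ => zero end) n
  ltac:(move=> k Hk; apply: Vn_derivative; apply: Hd; lia).
have E : sum_n (fun j => match j with 0%nat => B (orbit_int (Vn (n - j)) t v) | S _ => zero end) n
    = B (orbit_int (Vn n) t v).
  by rewrite (sum_n_head (fun j => B (orbit_int (Vn (n - j)) t v))) Nat.sub_0_r.
rewrite E in L2.
have -> : minus (Vn (S n) t v) (B (orbit_int (Vn n) t v)) =
  minus (minus (Vn (S n) t v) zero) (B (orbit_int (Vn n) t v)) by vsolve.
apply: lim0_ext (fl_minus _ _ _ _ _ (fl_minus _ _ _ _ _ L1 L0) L2) => h Hh.
have Hh0 : 0 <= h by lra.
have E1 : orbit_int (Vn (S n)) t v = minus (RInt (fun s => Vn (S n) s v) 0 (t + h))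
    (RInt (fun s => Vn (S n) s v) t (t + h)).
  rewrite /orbit_int -(RInt_plus_mid _ 0 t (t + h)) //; try lra. vsolve.
have E2 : RInt (fun s => Vn (S n) s v) h (t + h) =
    minus (RInt (fun s => Vn (S n) s v) 0 (t + h)) (orbit_int (Vn (S n)) h v).
  rewrite /orbit_int -(RInt_plus_mid _ 0 h (t + h)) //; try lra. vsolve.
have E3 : sum_n (fun j => scal (/ h) (Vn (S j) h (orbit_int (Vn (n - j)) t v))) n =
    scal (/ h) (sum_n (fun j => Vn (S j) h (orbit_int (Vn (n - j)) t v)) n).
  by rewrite -(lin_sum (fun x : X => scal (/ h) x)) //; exact: is_linear_scal_r Rmult_comm.
have := U_orbit_int_Vn n t h v Ht Hh0. rewrite E3 E2.
set s := sum_n _ n. set u1 := U h _ => E4.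
have -> : u1 = minus (plus u1 s) s by vsolve.
rewrite -E4 E1. vsolve; lra.
Qed.

Lemma orbit_int_Vn_dom n t v : 0 <= t -> dom A (orbit_int (Vn n) t v).
Proof.
move=> Ht. elim/(well_founded_induction Wf_nat.lt_wf): n => [[|n]] IH.
- have -> : orbit_int (Vn 0) t v = orbit_int U t v.
    apply: RInt_ext => s [Hs _]. rewrite Rmin_left // in Hs. rewrite Vn_0 //. lra.
  exact: (proj1 (orbit_int_U_dom t v Ht)).
- apply: (proj1 (orbit_int_Vn_step n t v Ht _)) => k Hk. apply: IH. lia.
Qed.

Lemma A_orbit_int_Vn_0 t v : 0 <= t -> A (orbit_int (Vn 0) t v) = minus (U t v) v.
Proof.
move=> Ht. have -> : orbit_int (Vn 0) t v = orbit_int U t v.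
  apply: RInt_ext => s [Hs _]. rewrite Rmin_left // in Hs. rewrite Vn_0 //. lra.
exact: (proj2 (orbit_int_U_dom t v Ht)).
Qed.

Lemma A_orbit_int_Vn_S n t v : 0 <= t ->
  A (orbit_int (Vn (S n)) t v) = minus (Vn (S n) t v) (B (orbit_int (Vn n) t v)).
Proof.
move=> Ht. apply: (proj2 (orbit_int_Vn_step n t v Ht _)) => k _.
exact: orbit_int_Vn_dom.
Qed.

(** * The sum of the Dyson-Phillips series *)

Lemma Wn_converges t u : 0 <= t ->
  exists w : X, filterlim (fun n => Wn n t u) eventually (locally w).
Proof.
move=> Ht.
have HC y : C y -> exists w : X, filterlim (fun n => Wn n t y) eventually (locally w).
  move=> Hy. apply: (cone_monotone_cv C Psi HX HPsi _ (Psi y)); last by move=> n; exact: Wn_Psi.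
  move=> n. rewrite Wn_S.
  have -> : minus (plus (Wn n t y) (Vn (S n) t y)) (Wn n t y) = Vn (S n) t y by vsolve.
  exact: Vn_cone.
have [y1 [y2 [H1 [H2 E]]]] := cone_generating HX u.
have [w1 L1] := HC y1 H1. have [w2 L2] := HC y2 H2.
exists (minus w1 w2). apply: filterlim_ext (fl_minus _ _ _ _ _ L1 L2) => n.
by rewrite E (lin_minus (Wn n t)) //; exact: Wn_lin.
Qed.

(** [epsilon] picks the limit, which exists for [t >= 0]; at negative times nothing is claimed about
    the value. *)
Definition Winf (t : R) (u : X) : X :=
  epsilon (inhabits (zero : X)) (fun w : X => filterlim (fun n => Wn n t u) eventually (locally w)).

Lemma Winf_lim t u : 0 <= t ->
  filterlim (fun n => Wn n t u) eventually (locally (Winf t u)).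
Proof. move=> Ht. exact: (epsilon_spec (inhabits (zero : X)) _ (Wn_converges t u Ht)). Qed.

Lemma Winf_unique t u w : 0 <= t ->
  filterlim (fun n => Wn n t u) eventually (locally w) -> Winf t u = w.
Proof.
move=> Ht H.
exact (filterlim_locally_unique (F := eventually) (FF := Proper_StrongProper _ eventually_filter)
  _ _ _ (Winf_lim t u Ht) H).
Qed.

Lemma Winf_bound t u : 0 <= t -> norm (Winf t u) <= 2 * M * norm u.
Proof.
move=> Ht. rewrite -(minus_zero_r (Winf t u)).
apply: (lim_norm_le eventually (fun n => Wn n t u)); first exact: Winf_lim.
exists 0%nat => n _. rewrite minus_zero_r. exact: Wn_bound.
Qed.

Lemma Winf_lin t : 0 <= t -> is_linear (Winf t).
Proof.
move=> Ht. split.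
- move=> u v. apply: Winf_unique => //.
  apply: filterlim_ext (fl_plus _ _ _ _ _ (Winf_lim t u Ht) (Winf_lim t v Ht)) => n.
  by rewrite (linear_plus _ (Wn_lin n t Ht)).
- move=> c u. apply: Winf_unique => //.
  apply: filterlim_ext (fl_scal _ c _ _ (Winf_lim t u Ht)) => n.
  by rewrite (linear_scal _ (Wn_lin n t Ht)).
- exists (2 * M + 1). split; first by have := HK; lra.
  move=> u. have := Winf_bound t u Ht. have := norm_ge_0 u. rewrite /=; lra.
Qed.

Lemma Winf_cone t u : 0 <= t -> C u -> C (Winf t u).
Proof.
move=> Ht Hu. apply: (cone_lim C HX eventually (fun m => Wn m t u)); last exact: Winf_lim.
exists 0%nat => m _. exact: Wn_cone.
Qed.

Lemma Winf_norm t u : 0 <= t -> C u -> norm (Winf t u) <= norm u.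
Proof.
move=> Ht Hu. rewrite -(minus_zero_r (Winf t u)).
apply: (lim_norm_le eventually (fun n => Wn n t u)); first exact: Winf_lim.
exists 0%nat => n _. rewrite minus_zero_r. exact: Wn_norm.
Qed.

Lemma Winf_short_time u eps : 0 < eps -> exists d, 0 < d /\
  forall h, 0 <= h < d -> norm (minus (Winf h u) u) <= eps.
Proof.
move=> He. have [q [Hq1 [_ Hq]]] := short_time u.
have [d [Hd H]] := Hq eps He. exists d; split=> // h Hh.
apply: (lim_norm_le eventually (fun n => Wn n h u)); first by apply: Winf_lim; lra.
exists 0%nat => n _. left. apply: Rle_lt_trans (Hq1 n h _) (H h Hh). lra.
Qed.

Lemma Winf_0 u : Winf 0 u = u.
Proof.
have E : minus (Winf 0 u) u = zero.
  apply: norm_zero_eq. apply: le_epsilon => eps He. rewrite Rplus_0_l.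
  have [d [Hd H]] := Winf_short_time u eps He. apply: H. lra.
have -> : Winf 0 u = plus (minus (Winf 0 u) u) u by vsolve.
by rewrite E plus_zero_l.
Qed.

(** On the cone, [Wn n (t + s) y] is a triangular sum and [Wn n t (Wn n s y)] a square one, over the
    same positive array. Passing to the limit in both comparisons gives the two inequalities, and
    the cone is pointed. *)
Lemma Winf_plus t s u : 0 <= t -> 0 <= s -> Winf (t + s) u = Winf t (Winf s u).
Proof.
move=> Ht Hs. have Hts : 0 <= t + s by lra.
have HC y : C y -> Winf (t + s) y = Winf t (Winf s y).
  move=> Hy. pose c k j := Vn k t (Vn j s y).
  have Hc k j : C (c k j) by apply: Vn_cone => //; exact: Vn_cone.
  have ET n : sum_n (fun m => sum_n (fun k => c k (m - k)%nat) m) n = Wn n (t + s) y.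
    apply: sum_n_ext => m. by rewrite Vn_plus.
  have EQ n : sum_n (fun k => sum_n (c k) n) n = Wn n t (Wn n s y).
    apply: sum_n_ext => k. by rewrite /c /Wn (lin_sum (Vn k t)) //; exact: Vn_lin.
  have LT := Winf_lim (t + s) y Hts.
  have LT2 := filterlim_comp _ _ _ _ _ _ _ _ eventually_double LT.
  have LQ : filterlim (fun n => Wn n t (Wn n s y)) eventually (locally (Winf t (Winf s y))).
    apply: (fl_family eventually (fun n => Wn n t) (2 * M) (fun n => Wn n s y) (Winf s y)).
    - exists 0%nat => n _. split; [exact: Wn_lin|move=> u'; exact: Wn_bound].
    - exact: Winf_lim.
    - exact: Winf_lim.
  apply: (cone_antisym C HX).
  - apply: (cone_lim C HX eventually _ _ _ (fl_minus _ _ _ _ _ LT2 LQ)).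
    exists 0%nat => n _. rewrite -ET -EQ.
    apply: triangle_minus_square => //; [exact: (cone_zero HX)|exact: (cone_plus HX)].
  - apply: (cone_lim C HX eventually _ _ _ (fl_minus _ _ _ _ _ LQ LT)).
    exists 0%nat => n _. rewrite -ET -EQ.
    apply: square_minus_triangle => //; [exact: (cone_zero HX)|exact: (cone_plus HX)].
have [y1 [y2 [H1 [H2 ->]]]] := cone_generating HX u.
rewrite (lin_minus (Winf (t + s))); last exact: Winf_lin.
rewrite (lin_minus (Winf s)); last exact: Winf_lin.
rewrite (lin_minus (Winf t)); last exact: Winf_lin.
by rewrite !HC.
Qed.

Lemma Winf_substochastic : substochastic C Winf.
Proof.
split; last by move=> t u Ht Hu; split; [exact: Winf_cone|exact: Winf_norm].
split.
- exact: Winf_lin.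
- exact: Winf_0.
- exact: Winf_plus.
- move=> u. apply/lim0_norm => eps He.
  have [d [Hd H]] := Winf_short_time u (eps / 2) ltac:(lra).
  exists d; split=> // h Hh. apply: Rle_lt_trans (H h _) _; lra.
Qed.

(** Minimality compares [V] with a semigroup together with its generator, so the generator has to be
    exhibited as an [operator]; its values are again chosen by [epsilon]. *)
Definition Winf_generator : operator X :=
  Operator (fun u => exists w : X, lim0 (fun t => scal (/ t) (minus (Winf t u) u)) w)
    (fun u => epsilon (inhabits (zero : X))
      (fun w : X => lim0 (fun t => scal (/ t) (minus (Winf t u) u)) w)).

Lemma Winf_is_generator : is_generator Winf Winf_generator.
Proof.
move=> u w. split.
- move=> [Hd <-]. exact: (epsilon_spec (inhabits (zero : X)) _ Hd).
- move=> Hl. have Hd : dom Winf_generator u by exists w.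
  split=> //. apply: (lim0_unique (X := X) _ _ _ _ Hl).
  exact: (epsilon_spec (inhabits (zero : X)) _ Hd).
Qed.

Lemma Winf_extends : extends_sum Winf_generator A B.
Proof.
move=> u Hu. apply: (generator_intro _ _ Winf_is_generator).
have LB : lim0 (fun h => scal (/ h) (minus (Winf h u) (U h u))) (B u).
  apply/lim0_norm => eps He.
  have [d [Hd H]] := Wn_derivative u Hu (eps / 2) ltac:(lra).
  exists d; split=> // h Hh. apply: (Rle_lt_trans _ (eps / 2)); last lra.
  have Hh0 : 0 <= h by lra.
  apply: (lim_norm_le eventually (fun n => scal (/ h) (minus (Wn n h u) (U h u)))).
  - apply: fl_scal. apply: fl_minus; [exact: Winf_lim|exact: filterlim_const].
  (* The index starts at 1, since for [Wn 0], which is [U], the quotient is zero and not close to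
     [B u]. *)
  - exists 1%nat => [[|n]] Hn; first lia. exact: H.
apply: lim0_ext (fl_plus _ _ _ _ _ (generator_lim U A HA u Hu) LB) => h Hh.
vsolve; lra.
Qed.

(** * Comparison with the minimal semigroup *)

Section Minimal.
Variables (V : R -> X -> X) (G : operator X).
Hypothesis HV : minimal_semigroup C A B V G.

Let HV1 : substochastic C V := proj1 HV.
Let HV0 : C0_semigroup V := proj1 HV1.
Let HG : is_generator V G := proj1 (proj2 HV).
Let HGAB : extends_sum G A B := proj1 (proj2 (proj2 HV)).
Let HVF := substochastic_family C M HM V HV1.

Lemma V_cone t u : 0 <= t -> C u -> C (V t u).
Proof. move=> Ht Hu. by case: (proj2 HV1 t u Ht Hu). Qed.

(** The function [V (t - s) (U s u) + int_0^s V (t - r) (B (U r u)) dr] is constant in [s]: as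
    [U s u] stays in the domain of [A], where [G] is [A + B], its right derivative is [V (t - s)]
    applied to [(A - G + B) (U s u) = 0]. *)
Lemma V_Duhamel t u : 0 <= t -> dom A u ->
  is_RInt (fun s => V (t - s) (B (U s u))) 0 t (minus (V t u) (U t u)).
Proof.
(* The truncation keeps the time argument of [V] nonnegative for [s > t], so that [cont0], which
   concerns the whole half-line, applies. *)
move=> Ht Hu. pose p s := Rmax 0 (t - s).
have Hp0 s : 0 <= s -> 0 <= p s by move=> _; exact: Rmax_l.
have Hpl s s' : Rabs (p s - p s') <= Rabs (s - s').
  apply: Rle_trans (Rmax0_lip _ _) _. right. rewrite Rabs_minus_sym. f_equal. ring.
have Hpt s : s <= t -> p s = t - s by move=> Hs; rewrite /p Rmax_right; lra.
pose f s := V (p s) (B (U s u)).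
have Hf : cont0 f.
  apply: (family_cont0 (2 * M) V HVF) => //. exact: BU_cont0.
pose F s := plus (V (p s) (U s u)) (RInt f 0 s).
have HF : F t = F 0.
  apply: right_derivative_zero => //.
    apply: cont0_plus; last exact: cont0_RInt.
    apply: (family_cont0 (2 * M) V HVF) => //. exact: (family_cont _ _ HUF).
  move=> s [Hs Hst]. have [Hd EA] := generator_comm U A HU0 HA s u Hs Hu.
  have [HdG EG] := HGAB _ Hd.
  have D1 := generator_right_deriv U A HU0 HA s u Hs Hu.
  have D2 := generator_lim V G HG _ HdG.
  (* Writing [V (t - s)] as [V (t - s - h)] composed with [V h] puts the whole quotient of the
     product under one operator, and joint continuity gives its limit. *)
  have D3 : lim0 (fun h => V (p (s + h)) (minus (scal (/ h) (minus (U (s + h) u) (U s u)))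
      (scal (/ h) (minus (V h (U s u)) (U s u)))))
      (V (p s) (minus (U s (A u)) (G (U s u)))).
    apply: (family_moving (2 * M) V HVF) => //.
    - exact: Hp0.
    - apply: at_right_pos => h Hh. exact: Rmax_l.
    - apply/(lim0_norm (X := R_NormedModule)) => eps He. exists eps; split=> // h Hh.
      apply: Rle_lt_trans (Hpl _ _) _.
      have -> : s + h - s = h by ring. rewrite Rabs_pos_eq; lra.
    - exact: fl_minus.
  have D4 := ftc_right f s Hf Hs.
  have EZ : zero = plus (V (p s) (minus (U s (A u)) (G (U s u)))) (f s).
    rewrite /f -(linear_plus _ (family_lin _ _ HVF _ (Hp0 s Hs))) EG EA.
    have -> : plus (minus (U s (A u)) (plus (U s (A u)) (B (U s u)))) (B (U s u)) = zero
      by vsolve.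
    by rewrite (lin_zero (V (p s))) //; exact: (family_lin _ _ HVF _ (Hp0 s Hs)).
  rewrite EZ. apply: filterlim_ext_loc (fl_plus _ _ _ _ _ D3 D4).
  apply: (at_right_intro _ (t - s)); first lra. move=> h Hh.
  have Hph : 0 <= p (s + h) by exact: Rmax_l.
  have HL := family_lin _ _ HVF _ Hph.
  have E1 : V (p s) (U s u) = V (p (s + h)) (V h (U s u)).
    rewrite -(semigroup_plus HV0) //; last lra. rewrite !Hpt; try lra.
    by have -> : t - (s + h) + h = t - s by ring.
  rewrite /F E1 -(RInt_plus_mid f 0 s (s + h)) //; try lra.
  rewrite (lin_minus (V (p (s + h)))) // !(linear_scal _ HL) !(lin_minus (V (p (s + h)))) //.
  vsolve; lra.
have E : RInt f 0 t = minus (V t u) (U t u).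
  move: HF. rewrite /F !Hpt; try lra.
  rewrite Rminus_eq_0 Rminus_0_r (semigroup_zero HV0) (semigroup_zero HU0) RInt_point.
  move=> HF. have -> : RInt f 0 t = minus (plus (U t u) (RInt f 0 t)) (U t u) by vsolve.
  rewrite HF. vsolve.
rewrite -E. apply: (is_RInt_ext f).
- rewrite Rmin_left // Rmax_right // => s Hs. rewrite /f Hpt //. lra.
- apply: is_RInt_RInt => //. lra.
Qed.

Lemma cone_minus_dense n t u : 0 <= t -> C u ->
  (forall v, dom A v -> C v -> C (minus (V t v) (Wn n t v))) -> C (minus (V t u) (Wn n t u)).
Proof.
move=> Ht Hu Hdom. have Ha := generator_approx (2 * M) U HK HU0 HUK u.
apply: (cone_lim C HX (at_right 0) _ _ _
  (fl_minus _ _ _ _ _ (fl_lin _ (V t) _ _ (family_lin _ _ HVF t Ht) Ha)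
    (fl_lin _ (Wn n t) _ _ (Wn_lin n t Ht) Ha))).
apply: at_right_pos => h Hh; apply: Hdom; first exact: (generator_approx_dom (2 * M)).
apply: (cone_scal HX); first by left; exact: Rinv_0_lt_compat.
apply: orbit_int_U_cone => //; lra.
Qed.

(** Both Duhamel formulas have the same inner factor [B (U s v)], which is positive. Their
    difference is thus an integral of [V - Wn n] at positive vectors, covered by the induction
    hypothesis. *)
Lemma Wn_le_V n t u : 0 <= t -> C u -> C (minus (V t u) (Wn n t u)).
Proof.
elim: n t u => [|n IH] t u Ht Hu; apply: cone_minus_dense => // v Hd Hv.
- rewrite Wn_0 //. apply: (cone_RInt C HX _ 0 t _ Ht _ (V_Duhamel t v Ht Hd)) => s Hs.
  apply: V_cone; first lra. apply: HBpos.
  + apply: (proj1 (generator_comm U A HU0 HA s v _ Hd)). lra.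
  + apply: U_cone => //. lra.
- have I := is_RInt_minus _ _ _ _ _ _ (V_Duhamel t v Ht Hd) (Wn_Duhamel n t v Ht Hd).
  have -> : minus (V t v) (Wn (S n) t v) =
    minus (minus (V t v) (U t v)) (minus (Wn (S n) t v) (U t v)) by vsolve.
  apply: (cone_RInt C HX _ 0 t _ Ht _ I) => s Hs. apply: IH; first lra. apply: HBpos.
  + apply: (proj1 (generator_comm U A HU0 HA s v _ Hd)). lra.
  + apply: U_cone => //. lra.
Qed.

Lemma V_eq_Winf t u : 0 <= t -> V t u = Winf t u.
Proof.
move=> Ht.
have HC y : C y -> V t y = Winf t y.
  move=> Hy. apply: (cone_antisym C HX).
  - apply: (cone_lim C HX eventually (fun n => minus (V t y) (Wn n t y))).
    + exists 0%nat => n _. exact: Wn_le_V.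
    + apply: fl_minus; [exact: filterlim_const|exact: Winf_lim].
  - have [_ [_ [_ Hmin]]] := HV.
    exact: (Hmin _ _ Winf_substochastic Winf_is_generator Winf_extends).
have [y1 [y2 [H1 [H2 ->]]]] := cone_generating HX u.
rewrite (lin_minus (V t)); last exact: (semigroup_bounded HV0).
rewrite (lin_minus (Winf t)); last exact: Winf_lin.
by rewrite !HC.
Qed.

Lemma Wn_lim_V t u : 0 <= t -> filterlim (fun n => Wn n t u) eventually (locally (V t u)).
Proof. move=> Ht. rewrite V_eq_Winf //. exact: Winf_lim. Qed.

(** * The functional a-hat *)

Definition an (n : nat) (t : R) (v : X) : R := frak_a Psi A B (orbit_int (Vn n) t v).

Lemma orbit_int_Vn_cone n t v : 0 <= t -> C v -> C (orbit_int (Vn n) t v).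
Proof.
move=> Ht Hv. apply: (cone_RInt C HX (fun s => Vn n s v) 0 t) => //.
- move=> s Hs. apply: Vn_cone => //. lra.
- exact: (orbit_RInt _ _ (Vn_family n)).
Qed.

Lemma an_plus n t u v : 0 <= t -> an n t (plus u v) = an n t u + an n t v.
Proof.
move=> Ht. rewrite /an /frak_a (orbit_int_plus _ _ (Vn_family n)) //.
have Du := orbit_int_Vn_dom n t u Ht. have Dv := orbit_int_Vn_dom n t v Ht.
rewrite (proj2 (generator_plus U A HU0 HA _ _ Du Dv)) (proj1 HBlin) //.
rewrite !(Psi_plus C) //. ring.
Qed.

Lemma an_scal n t c u : 0 <= t -> an n t (scal c u) = c * an n t u.
Proof.
move=> Ht. rewrite /an /frak_a (orbit_int_scal _ _ (Vn_family n)) //.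
have Du := orbit_int_Vn_dom n t u Ht.
rewrite (proj2 (generator_scal U A HU0 HA c _ Du)) (proj2 HBlin) //.
rewrite !(Psi_plus C) // !(Psi_scal C) //. ring.
Qed.

Lemma an_ge_0 n t v : 0 <= t -> C v -> 0 <= an n t v.
Proof.
move=> Ht Hv. have := HAB _ (orbit_int_Vn_dom n t v Ht) (orbit_int_Vn_cone n t v Ht Hv).
rewrite /an /frak_a. lra.
Qed.

Definition An (n : nat) (t : R) (v : X) : R := sum_n (fun k => an k t v) n.

(** The [B] term of index [k] cancels against the one in [A (orbit_int (Vn (S k)) t v)], so only the
    last [B] term is left. *)
Lemma An_telescope n t v : 0 <= t ->
  An n t v = Psi v - Psi (Wn n t v) - Psi (B (orbit_int (Vn n) t v)).
Proof.
move=> Ht. elim: n => [|n IH].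
- rewrite /An sum_O /an /frak_a A_orbit_int_Vn_0 // Wn_0 //.
  rewrite (Psi_plus C) // (Psi_minus C) //. ring.
- rewrite /An sum_Sn. rewrite /An in IH. rewrite IH /an /frak_a A_orbit_int_Vn_S // Wn_S.
  rewrite /minus !(Psi_plus C) // (Psi_opp C) // /plus /=. ring.
Qed.

Lemma An_cone n t v : 0 <= t -> C v -> 0 <= An n t v <= Psi v - Psi (Wn n t v).
Proof.
move=> Ht Hv. split.
- apply: (sum_n_closed (G := R_AbelianMonoid) (fun x : R => 0 <= x)) => [x y|k _].
  + exact: Rplus_le_le_0_compat.
  + exact: an_ge_0.
- rewrite An_telescope //.
  have := Psi_ge_0 C Psi HPsi _ (HBpos _ (orbit_int_Vn_dom n t v Ht)
    (orbit_int_Vn_cone n t v Ht Hv)). lra.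
Qed.

(** The constant is [M] and not [2 * M], because [L u] is a difference of two numbers that both lie
    in [[0, M * norm u]]. *)
Lemma functional_bound (L : X -> R) :
  (forall u v, L (plus u v) = L u + L v) -> (forall c u, L (scal c u) = c * L u) ->
  (forall u, C u -> 0 <= L u <= norm u) ->
  (forall u, Rabs (L u) <= M * norm u) /\ is_linear (V := R_NormedModule) L.
Proof.
move=> Hp Hs HC.
have Hb u : Rabs (L u) <= M * norm u.
  have [u1 [u2 [H1 [H2 [E [H3 H4]]]]]] := proj2 HM u.
  have El : L u = L u1 - L u2.
    have -> : u = plus u1 (scal (-1) u2) by rewrite E; vsolve.
    rewrite Hp Hs. ring.
  rewrite El. have := HC _ H1. have := HC _ H2. move=> ? ?. apply: Rabs_le. lra.
split=> //. split=> //.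
exists (M + 1). have HM0 := proj1 HM. split; first lra.
move=> u. apply: Rle_trans (Hb u) _. have := norm_ge_0 u. rewrite /=; lra.
Qed.

Lemma An_linear n t : 0 <= t ->
  (forall u, Rabs (An n t u) <= M * norm u) /\ is_linear (V := R_NormedModule) (An n t).
Proof.
move=> Ht. apply: functional_bound.
- move=> u v. rewrite /An.
  rewrite (sum_n_ext _ (fun k => plus (an k t u) (an k t v))); last by move=> k; exact: an_plus.
  exact: sum_n_plus.
- move=> c u. rewrite /An.
  rewrite (sum_n_ext _ (fun k => mult c (an k t u))); last by move=> k; exact: an_scal.
  exact: sum_n_mult_l.
- move=> u Hu. have := An_cone n t u Ht Hu.
  have := Psi_ge_0 C Psi HPsi _ (Wn_cone n t u Ht Hu). rewrite (Psi_cone C Psi HPsi u) //. lra.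
Qed.

Lemma an_ex_series t v : 0 <= t -> ex_series (fun n => an n t v).
Proof.
move=> Ht.
have HC u : C u -> ex_series (fun n => an n t u).
  move=> Hu. have [l Hl] : ex_finite_lim_seq (fun n => An n t u).
    apply: (ex_finite_lim_seq_incr _ (Psi u)) => n.
    - rewrite /An sum_Sn /plus /=. have := an_ge_0 (S n) t u Ht Hu. lra.
    - have := An_cone n t u Ht Hu. have := Psi_ge_0 C Psi HPsi _ (Wn_cone n t u Ht Hu). lra.
  by exists l.
have [y1 [y2 [H1 [H2 ->]]]] := cone_generating HX v.
apply: (ex_series_ext (fun n => minus (an n t y1) (an n t y2))).
  move=> n. have -> : minus y1 y2 = plus y1 (scal (-1) y2) by vsolve.
  rewrite an_plus // an_scal // /minus /plus /opp /=. ring.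
apply: ex_series_minus; exact: HC.
Qed.

Definition alpha (t : R) (v : X) : R := Series (fun n => an n t v).

Lemma alpha_lim t v : 0 <= t ->
  filterlim (fun n => An n t v) eventually (locally (alpha t v)).
Proof. move=> Ht. exact: (Series_correct _ (an_ex_series t v Ht)). Qed.

Lemma alpha_cone t v : 0 <= t -> C v -> 0 <= alpha t v <= Psi v - Psi (V t v).
Proof.
move=> Ht Hv. split.
- apply: (lim_seq_le (fun _ => 0) (fun n => An n t v)).
  + move=> n. by case: (An_cone n t v Ht Hv).
  + exact: filterlim_const.
  + exact: alpha_lim.
- apply: (lim_seq_le (fun n => An n t v) (fun n => Psi v - Psi (Wn n t v))).
  + move=> n. by case: (An_cone n t v Ht Hv).
  + exact: alpha_lim.
  + apply: (fl_minus (X := R_NormedModule)); first exact: filterlim_const.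
    apply: (fl_lin (Y := R_NormedModule) _ Psi); [exact: (proj1 HPsi)|exact: Wn_lim_V].
Qed.

Lemma alpha_linear t : 0 <= t ->
  (forall u, Rabs (alpha t u) <= M * norm u) /\ is_linear (V := R_NormedModule) (alpha t).
Proof.
move=> Ht. apply: functional_bound.
- move=> u v. rewrite /alpha -Series_plus; try exact: an_ex_series.
  apply: Series_ext => n. exact: an_plus.
- move=> c u. rewrite /alpha -Series_scal_l. apply: Series_ext => n. exact: an_scal.
- move=> u Hu. have := alpha_cone t u Ht Hu.
  have := Psi_ge_0 C Psi HPsi _ (V_cone t u Ht Hu). rewrite (Psi_cone C Psi HPsi u) //. lra.
Qed.

Lemma alpha_minus t u v : 0 <= t -> alpha t (minus u v) = alpha t u - alpha t v.
Proof. move=> Ht. exact: (lin_minus (Y := R_NormedModule) _ u v (proj2 (alpha_linear t Ht))). Qed.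

(** The orbit integral is split at [t], and [Vn_plus] expands the second piece into orbit integrals
    over [[0, s]]. Each lies in the domain of [A], where [frak_a] is additive. *)
Lemma an_shift n t s v : 0 <= t -> 0 <= s ->
  an n (t + s) v = an n t v + sum_n (fun k => an k s (Vn (n - k) t v)) n.
Proof.
move=> Ht Hs.
have E : orbit_int (Vn n) (t + s) v =
    plus (orbit_int (Vn n) t v) (sum_n (fun k => orbit_int (Vn k) s (Vn (n - k) t v)) n).
  rewrite (orbit_int_split _ _ (Vn_family n)) //. congr plus.
  have I : is_RInt (fun r => Vn n (r + t) v) 0 s (RInt (fun r => Vn n r v) t (t + s)).
    apply: (is_RInt_shift (fun r => Vn n r v)). rewrite Rplus_0_l (Rplus_comm s).
    apply: is_RInt_RInt; [exact: Vn_cont0|lra|lra].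
  rewrite -(is_RInt_unique _ _ _ _ I). apply: is_RInt_unique.
  apply: (is_RInt_ext (fun r => sum_n (fun k => Vn k r (Vn (n - k) t v)) n)).
    rewrite Rmin_left // => r [Hr _]. rewrite Vn_plus //. lra.
  apply: (is_RInt_sum_n (fun k r => Vn k r (Vn (n - k) t v))) => k.
  exact (orbit_RInt _ _ (Vn_family k) s _ Hs).
have frak_plus x y : dom A x -> dom A y ->
    frak_a Psi A B (plus x y) = frak_a Psi A B x + frak_a Psi A B y.
  move=> Hx Hy. rewrite /frak_a (proj2 (generator_plus U A HU0 HA _ _ Hx Hy)) (proj1 HBlin) //.
  rewrite !(Psi_plus C) //. ring.
have Hsum (x : nat -> X) m : (forall k, dom A (x k)) -> dom A (sum_n x m) /\
    frak_a Psi A B (sum_n x m) = sum_n (fun k => frak_a Psi A B (x k)) m.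
  move=> Hx. elim: m => [|m [IHd IH]]; first by rewrite !sum_O.
  rewrite !sum_Sn frak_plus // IH. split=> //.
  exact: (proj1 (generator_plus U A HU0 HA _ _ IHd (Hx _))).
have [Hd Es] := Hsum (fun k => orbit_int (Vn k) s (Vn (n - k) t v)) n
  (fun k => orbit_int_Vn_dom k s _ Hs).
rewrite /an E frak_plus //; first by rewrite Es. exact: orbit_int_Vn_dom.
Qed.

(** By [an_shift], [An n (t + s) y - An n t y] is a triangular sum of nonnegative reals, while
    [An n s (Wn n t y)] is the square sum of the same array; the two therefore share their limit. *)
Lemma alpha_shift t s v : 0 <= t -> 0 <= s ->
  alpha (t + s) v = alpha t v + alpha s (V t v).
Proof.
move=> Ht Hs. have Hts : 0 <= t + s by lra.
have HC y : C y -> alpha (t + s) y = alpha t y + alpha s (V t y).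
  move=> Hy. pose c k j : R := an k s (Vn j t y).
  have Hc k j : 0 <= c k j by apply: an_ge_0 => //; exact: Vn_cone.
  have P0 : 0 <= (zero : R) by exact: Rle_refl.
  have Pp (x z : R) : 0 <= x -> 0 <= z -> 0 <= plus x z by exact: Rplus_le_le_0_compat.
  pose Tn n := sum_n (fun m => sum_n (fun k => c k (m - k)%nat) m) n.
  have LT : filterlim Tn eventually (locally (alpha (t + s) y - alpha t y)).
    apply: filterlim_ext (fl_minus (X := R_NormedModule) _ _ _ _ _
      (alpha_lim (t + s) y Hts) (alpha_lim t y Ht)) => n.
    have -> : An n (t + s) y = plus (An n t y) (Tn n).
      rewrite /An /Tn -sum_n_plus. apply: sum_n_ext => m. exact: an_shift.
    rewrite /minus /plus /opp /=. ring.
  have LT2 := filterlim_comp _ _ _ _ _ _ _ _ eventually_double LT.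
  have LQ : filterlim (fun n => An n s (Wn n t y)) eventually (locally (alpha s (V t y))).
    apply: (fl_family (Y := R_NormedModule) eventually (fun n => An n s) M
      (fun n => Wn n t y) (V t y)).
    - exists 0%nat => n _. by case: (An_linear n s Hs).
    - exact: Wn_lim_V.
    - exact: alpha_lim.
  have EQ n : sum_n (fun k => sum_n (c k) n) n = An n s (Wn n t y).
    rewrite /Wn (lin_sum (Y := R_NormedModule) (An n s)); last by case: (An_linear n s Hs).
    exact: sum_n_switch.
  have G1 := lim_seq_le _ _ _ _ (fun n => _) LT LQ.
  have G2 := lim_seq_le _ _ _ _ (fun n => _) LQ LT2.
  have : alpha (t + s) y - alpha t y <= alpha s (V t y).
    apply: G1 => n. rewrite -EQ.
    have H : 0 <= sum_n (fun k => sum_n (c k) n) n - Tn n :=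
      square_minus_triangle (X := R_NormedModule) (fun x : R => 0 <= x) P0 Pp c Hc n.
    lra.
  have : alpha s (V t y) <= alpha (t + s) y - alpha t y.
    apply: G2 => n. rewrite -EQ.
    have H : 0 <= Tn (n + n)%nat - sum_n (fun k => sum_n (c k) n) n :=
      triangle_minus_square (X := R_NormedModule) (fun x : R => 0 <= x) P0 Pp c Hc n.
    lra.
  lra.
have [y1 [y2 [H1 [H2 ->]]]] := cone_generating HX v.
rewrite (lin_minus (V t)); last exact: (semigroup_bounded HV0).
rewrite !alpha_minus // !HC //. ring.
Qed.

Lemma alpha_0 v : alpha 0 v = 0.
Proof.
have := alpha_shift 0 0 v (Rle_refl 0) (Rle_refl 0).
rewrite Rplus_0_r (semigroup_zero HV0). lra.
Qed.

(** By [alpha_shift] the increment from [t] to [s] is [alpha (s - t) (V t y)], which is dominated by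
    the mass that [V] loses on the two positive parts of [y] between these times. *)
Lemma alpha_cont0 y : cont0 (X := R_NormedModule) (fun t => alpha t y).
Proof.
have [y1 [y2 [H1 [H2 E]]]] := cone_generating HX y.
apply: (cont0_dominated (X := R_NormedModule) _ (fun t => Psi (plus (V t y1) (V t y2)))).
- apply: (cont0_lin (Y := R_NormedModule)); first exact: (proj1 HPsi).
  apply: cont0_plus; exact: (family_cont _ _ HVF).
- move=> t s Hts. have Ht : 0 <= t by lra. have Hh : 0 <= s - t by lra.
  have Ea := alpha_shift t (s - t) y Ht Hh.
  have Es : t + (s - t) = s by ring.
  have EV : V t y = minus (V t y1) (V t y2).
    by rewrite E (lin_minus (V t)) //; exact: (semigroup_bounded HV0).
  rewrite EV alpha_minus // Es in Ea.
  have B1 := alpha_cone (s - t) _ Hh (V_cone t y1 Ht H1).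
  have B2 := alpha_cone (s - t) _ Hh (V_cone t y2 Ht H2).
  rewrite -!(semigroup_plus HV0) // Rplus_comm Es in B1, B2.
  rewrite !(Psi_plus C) //.
  change (Rabs (alpha s y - alpha t y) <=
    Rabs (Psi (V s y1) + Psi (V s y2) - (Psi (V t y1) + Psi (V t y2)))).
  rewrite (Rabs_minus_sym (Psi (V s y1) + _)). apply: Rle_trans (Rle_abs _).
  apply: Rabs_le. lra.
Qed.

Definition corrected_alpha (v : X) (t : R) : R :=
  alpha t v - RInt (V := R_CompleteNormedModule) (fun r => alpha r (G v)) 0 t.

Lemma V_orbit t v : 0 <= t -> dom G v -> V t v = plus v (orbit_int V t (G v)).
Proof.
move=> Ht Hv.
rewrite (orbit_int_generator (2 * M) V G HK HV0
  (substochastic_bound C M HM V HV1) HG t v Ht Hv). vsolve.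
Qed.

(** The defect from additivity of [alpha] is [alpha s] applied to [int_0^t V r (G v) dr]. Moved
    under the integral, [alpha s (V r y)] is [alpha (r + s) y - alpha r y], so the defect equals
    that of the subtracted integral. *)
Lemma corrected_alpha_additive v t s : dom G v -> 0 <= t -> 0 <= s ->
  corrected_alpha v (t + s) = corrected_alpha v t + corrected_alpha v s.
Proof.
move=> Hv Ht Hs. rewrite /corrected_alpha alpha_shift //.
have [_ HL] := alpha_linear s Hs.
rewrite {1}(V_orbit t v Ht Hv) (linear_plus _ HL).
set y := G v. pose g r := alpha r y.
have Hg : cont0 (X := R_NormedModule) g := alpha_cont0 y.
have I1 := is_RInt_lin (Y := R_NormedModule) (alpha s) _ _ _ _ HL (orbit_RInt _ _ HVF t y Ht).
have I2 : is_RInt (V := R_NormedModule) (fun r => minus (g (r + s)) (g r)) 0 t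
    (minus (RInt (V := R_CompleteNormedModule) g s (t + s))
      (RInt (V := R_CompleteNormedModule) g 0 t)).
  apply: is_RInt_minus.
  - apply: (is_RInt_shift (X := R_CompleteNormedModule) g). rewrite Rplus_0_l.
    apply: (is_RInt_RInt (X := R_CompleteNormedModule)) => //. lra.
  - apply: (is_RInt_RInt (X := R_CompleteNormedModule)) => //. lra.
have E : alpha s (orbit_int V t y) = minus (RInt (V := R_CompleteNormedModule) g s (t + s))
      (RInt (V := R_CompleteNormedModule) g 0 t).
  rewrite -(is_RInt_unique (V := R_CompleteNormedModule) _ _ _ _ I1).
  apply: (is_RInt_unique (V := R_CompleteNormedModule)).
  apply: is_RInt_ext I2 => r. rewrite Rmin_left // => [[Hr _]].
  rewrite /g alpha_shift //; last lra. rewrite /minus /plus /opp /=. ring.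
rewrite E.
have Em := RInt_plus_mid (X := R_CompleteNormedModule) g 0 s (t + s) Hg (Rle_refl 0) Hs
  ltac:(lra).
rewrite -[RInt (fun r => alpha r y) 0 (t + s)]Em /minus /plus /opp /= /g. ring.
Qed.

Lemma corrected_alpha_bound v t : 0 <= t ->
  Rabs (corrected_alpha v t) <= M * norm v + t * (M * norm (G v)).
Proof.
move=> Ht. rewrite /corrected_alpha.
apply: Rle_trans; first exact: Rabs_triang. rewrite Rabs_Ropp.
apply: Rplus_le_compat; first by case: (alpha_linear t Ht).
have -> : t * (M * norm (G v)) = (t - 0) * (M * norm (G v)) by ring.
apply: (RInt_norm_le (X := R_CompleteNormedModule)) => //.
- exact: alpha_cont0.
- lra.
- move=> s Hs. apply: (proj1 (alpha_linear s _)). lra.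
Qed.

Lemma alpha_derivative v : dom G v ->
  filterlim (fun t => / t * alpha t v) (at_right 0) (locally (corrected_alpha v 1)).
Proof.
move=> Hv.
have Hlin := additive_bounded_linear (corrected_alpha v)
  (M * norm v + M * norm (G v))
  (fun t s => corrected_alpha_additive v t s Hv) _.
have {}Hlin : forall t, 0 <= t <= 1 -> corrected_alpha v t = t * corrected_alpha v 1.
  apply: Hlin => t Ht. apply: Rle_trans (corrected_alpha_bound v t _) _; first lra.
  have : 0 <= M * norm (G v) by apply: Rmult_le_pos; [case: HM; lra|exact: norm_ge_0].
  nra.
have L := ftc_right (X := R_CompleteNormedModule) _ 0 (alpha_cont0 (G v)) (Rle_refl 0).
rewrite alpha_0 in L.
pose proof (fl_plus (X := R_NormedModule) (at_right 0) _ _ _ _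
  (filterlim_const (F := at_right 0) (corrected_alpha v 1)) L) as L1.
rewrite {2}/plus /= Rplus_0_r in L1.
refine (filterlim_ext_loc (F := at_right 0) _ _ _ L1).
apply: (at_right_intro _ 1); first lra.
move=> h Hh. rewrite Rplus_0_l /plus /scal /= /mult /=.
have := Hlin h ltac:(lra). rewrite {1}/corrected_alpha => E.
have -> : alpha h v = h * corrected_alpha v 1 +
  RInt (V := R_CompleteNormedModule) (fun r => alpha r (G v)) 0 h by lra.
field. lra.
Qed.

Lemma a_hat_exists v : dom G v -> exists l : R,
  is_a_hat Psi A B Vn v l /\
  Rabs l <= 4 * M * (norm v + norm (G v)) /\
  (C v -> l <= frak_a0 Psi G v /\ frak_a0 Psi G v <= norm (G v)).
Proof.
move=> Hv. have Hd := alpha_derivative v Hv.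
exists (corrected_alpha v 1). split; [split; [|split]|split].
- move=> n t Ht. split.
  + apply: ex_RInt_cont0; [exact: Vn_cont0|lra|lra].
  + apply: orbit_int_Vn_dom. lra.
- move=> t Ht. apply: an_ex_series. lra.
- exact: Hd.
(* At time 1 the bound reads [M * norm v + M * norm (G v)]. *)
- apply: Rle_trans (corrected_alpha_bound v 1 _) _; first lra.
  have := norm_ge_0 v. have := norm_ge_0 (G v). have := proj1 HM. rewrite /=. nra.
- move=> Cv. rewrite /frak_a0.
  have LP : lim0 (fun h => opp (Psi (scal (/ h) (minus (V h v) v)))) (opp (Psi (G v))).
    apply: (fl_opp (X := R_NormedModule)).
    apply: (fl_lin (Y := R_NormedModule) _ Psi); first exact: (proj1 HPsi).
    exact: (generator_lim V G HG).
  split.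
  + apply: lim0_le Hd LP. apply: at_right_pos => h Hh.
    have Hh0 : 0 <= h by lra.
    have [_ Ha] := alpha_cone h v Hh0 Cv.
    rewrite (Psi_scal C) // (Psi_minus C) // /opp /=.
    have := Rmult_le_compat_l _ _ _ (Rlt_le _ _ (Rinv_0_lt_compat _ Hh)) Ha. lra.
  (* As [v] and [V h v] are both in the cone, [Psi] of the quotient is a difference of norms over
     [h], which the reverse triangle inequality bounds by the norm of the quotient. *)
  + have LN := filterlim_comp _ _ _ _ _ _ _ _ (generator_lim V G HG v Hv) (filterlim_norm (G v)).
    apply: lim0_le LP LN. apply: at_right_pos => h Hh.
    have Hh0 : 0 <= h by lra.
    have Hi := Rinv_0_lt_compat _ Hh.
    have En : minus v (V h v) = scal (- h) (scal (/ h) (minus (V h v) v)) by vsolve; lra.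
    have Ht : norm v <= norm (V h v) + h * norm (scal (/ h) (minus (V h v) v)).
      have {1}-> : v = plus (V h v) (minus v (V h v)) by vsolve.
      apply: Rle_trans; first exact: norm_triangle. apply: Rplus_le_compat_l.
      rewrite En. apply: Rle_trans; first exact: norm_scal.
      rewrite (_ : @abs R_AbsRing (- h) = h); first exact: Rle_refl.
      change (Rabs (- h) = h). rewrite Rabs_Ropp Rabs_pos_eq; lra.
    rewrite (Psi_scal C) // (Psi_minus C) // !(Psi_cone C Psi HPsi) //; last exact: V_cone.
    change (- (/ h * (norm (V h v) - norm v)) <= norm (scal (/ h) (minus (V h v) v))).
    apply: (Rmult_le_reg_l h) => //.
    have -> : h * - (/ h * (norm (V h v) - norm v)) = norm v - norm (V h v) by field; lra.
    lra.
Qed.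

End Minimal.
End Perturbation.

Theorem proposition4p5
  (X : CompleteNormedModule R_AbsRing) (C : X -> Prop) (Psi : X -> R) (M : R)
  (U : R -> X -> X) (A : operator X) (B : X -> X)
  (V : R -> X -> X) (G : operator X) (Vn : nat -> R -> X -> X)
  (HX : abstract_state_space C)
  (HPsi : norm_functional C Psi)
  (HM : decomposition_constant C M)
  (HU : substochastic C U)
  (HA : is_generator U A)
  (HBlin : linear_on (dom A) B)
  (HBpos : positive_on C (dom A) B)
  (HAB : forall u, dom A u -> C u -> Psi (plus (A u) (B u)) <= 0)
  (HV : minimal_semigroup C A B V G)
  (HVn : dyson_phillips C U A B Vn) :
  forall v, dom G v ->
    exists l : R,
      is_a_hat Psi A B Vn v l /\
      Rabs l <= 4 * M * (norm v + norm (G v)) /\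
      (C v -> l <= frak_a0 Psi G v /\ frak_a0 Psi G v <= norm (G v)).
Proof.
exact: (a_hat_exists C Psi M U A B Vn HX HPsi HM HU HA HBlin HBpos HAB HVn V G HV).
Qed.
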